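(* Let $L$ be a Lie superalgebra with a direct sum decomposition $L=K\oplus V$ (as a $\mathbb{Z}_2$-graded vector space), where $K$ and $V$ are subalgebras and $V$ is Abelian, and let $P\colon L\to V$ be the projector onto $V$ parallel to $K$. Let $D\colon L\to L$ be an odd derivation such that $D^2=0$ and $D(K)\subset K$. Endow $\Pi L\oplus V$ with the $L_\infty$-algebra structure whose brackets are, for $x,y\in L$ and $a,a_i\in V$: zero $0$-ary bracket; unary bracket $d(\Pi x,a)=(-\Pi Dx,\ P(x+Da))$; $\{\Pi x,\Pi y\}=(-1)^{\tilde x}\Pi[x,y]$; $\{\Pi x,a_1,\ldots,a_n\}=P[\ldots[x,a_1],\ldots,a_n]$ and $\{a_1,\ldots,a_n\}=P[\ldots[Da_1,a_2],\ldots,a_n]$ for $n\ge1$; all other brackets not obtained from these by symmetry and multilinearity being zero. Endow $\Pi L$ with the $L_\infty$-structure with unary bracket $\Pi x\mapsto-\Pi Dx$, binary bracket $\{\Pi x,\Pi y\}=(-1)^{\tilde x}\Pi[x,y]$ and all other brackets zero, and $\Pi K\subset\Pi L$ with the restricted structure. Let $i\colon\Pi K\to\Pi L$ be the inclusion, $j\colon\Pi K\to\Pi L\oplus V$, $j(\Pi x)=(\Pi x,0)$, and $p\colon\Pi L\oplus V\to\Pi L$, $p(\Pi x,a)=\Pi x$. Then $\Pi L\oplus V$, with $j$ and $p$, is a cocylinder for $i$ in the category of $L_\infty$-algebras: $j$ and $p$ are morphisms of $L_\infty$-algebras, $i=p\circ j$, $j$ is a monomorphism (cofibration) and a quasi-isomorphism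 (weak equivalence), and $p$ is an epimorphism (fibration). Moreover, $V=\operatorname{Ker}p$ with the higher derived brackets $\{a_1,\ldots,a_n\}_D=P[\ldots[Da_1,a_2],\ldots,a_n]$ of $D$, $n\ge1$, is a homotopy fiber (cocone), in this category, of the inclusion of differential Lie superalgebras $i$; that is, $V$ with these brackets is the fiber (kernel) of $p$ as an $L_\infty$-algebra.
   Context: Vector spaces are $\mathbb{Z}_2$-graded over a fixed field of characteristic zero; the parity of a homogeneous $a$ is $\tilde a\in\{0,1\}$; symmetry, derivations, Lie brackets, etc. are understood in the $\mathbb{Z}_2$-graded (super) sense. $\Pi$ is the parity reversion functor: $\Pi x$ has parity $\tilde x+1$. An $L_\infty$-algebra is a vector space $W$ endowed with a sequence of odd symmetric $k$-linear operations, $k=0,1,2,\ldots$, such that for all $n\ge 0$ the Jacobiators $$J^n(w_1,\ldots,w_n)=\sum_{k+l=n}\ \sum_{(k,l)\text{-shuffles }\sigma}(-1)^{\varepsilon}\{\{w_{\sigma(1)},\ldots,w_{\sigma(k)}\},w_{\sigma(k+1)},\ldots,w_{\sigma(n)}\}$$ vanish, where $(-1)^\varepsilon$ is the usual sign of the permutation of graded-commuting homogeneous elements. When the $0$-ary bracket is zero the unary bracket is a differential; quasi-isomorphism means inducing an isomorphism on its cohomology. Morphisms are taken to be even linear maps preserving all brackets. A cocylinder diagram for a map $f\colon X\to Y$ is a factorization $f=p\circ j$, $X\xrightarrow{j}Z\xrightarrow{p}Y$, with $j$ a cofibration and weak equivalence and $p$ a fibration; the homotopy fiber (cocone) of $f$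 is the fiber (kernel) of $p$. *)

(* Defs.v *)
From HB Require Import structures.
From mathcomp Require Import all_boot all_order all_fingroup all_algebra.

Set Implicit Arguments.
Unset Strict Implicit.
Unset Printing Implicit Defensive.

Import GRing.Theory.
Local Open Scope ring_scope.

(* Parities are booleans: false is even, true is odd.  A Z_2-grading is given *)
(* by the projections [pcomp b] onto the component of parity b.                *)
Record superSpace (F : fieldType) := SuperSpace {
  ss_sort :> lmodType F;
  pcomp : bool -> ss_sort -> ss_sort;
  pcomp_linear : forall b, linear (pcomp b);
  pcomp_comp : forall b c v, pcomp b (pcomp c v) = if b == c then pcomp c v else 0;
  pcomp_sum : forall v, pcomp false v + pcomp true v = v }.

(* The zero vector is homogeneous of both parities. *)
Definition homog (F : fieldType) (W : superSpace F) (b : bool) (w : W) : Prop :=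
  pcomp b w = w.

Record gradedSub (F : fieldType) (W : superSpace F) := GradedSub {
  gs_pred :> submodClosed W;
  gs_comp : forall b w, w \in gs_pred -> pcomp b w \in gs_pred }.

Section SubSpace.
Variables (F : fieldType) (W : superSpace F) (S : gradedSub W).

Record subsp := Subsp { subsp_val : W; _ : subsp_val \in gs_pred S }.
HB.instance Definition _ := [isSub for subsp_val].
HB.instance Definition _ := [Choice of subsp by <:].
HB.instance Definition _ := [SubChoice_isSubLmodule of subsp by <:].

Definition sub_comp (b : bool) (w : subsp) : subsp :=
  Subsp (gs_comp b (valP w)).

Fact sub_comp_linear b : linear (sub_comp b).
Proof. by move=> c u v; apply: val_inj; rewrite /= pcomp_linear. Qed.

Fact sub_comp_comp b c w :
  sub_comp b (sub_comp c w) = if b == c then sub_comp c w else 0.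
Proof. by apply: val_inj; rewrite /= pcomp_comp; case: eqP. Qed.

Fact sub_comp_sum w : sub_comp false w + sub_comp true w = w.
Proof. by apply: val_inj; rewrite /= pcomp_sum. Qed.

Definition sub_space : superSpace F :=
  SuperSpace sub_comp_linear sub_comp_comp sub_comp_sum.

End SubSpace.

(* The parity reversion functor keeps the underlying vector space, so that    *)
(* the element Pi x is x itself, with the opposite parity.                    *)
Section ParityReversion.
Variables (F : fieldType) (W : superSpace F).

Fact pi_comp_comp b c (w : W) :
  pcomp (~~ b) (pcomp (~~ c) w) = if b == c then pcomp (~~ c) w else 0.
Proof. by rewrite pcomp_comp (inj_eq negb_inj). Qed.

Fact pi_comp_sum (w : W) : pcomp (~~ false) w + pcomp (~~ true) w = w.
Proof. by rewrite addrC pcomp_sum. Qed.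

Definition Pi_space : superSpace F :=
  @SuperSpace F W (fun b => pcomp (~~ b)) (fun b => pcomp_linear (~~ b))
    pi_comp_comp pi_comp_sum.

End ParityReversion.

Section DirectSum.
Variables (F : fieldType) (U W : superSpace F).

Definition dsum_comp (b : bool) (w : U * W) : U * W := (pcomp b w.1, pcomp b w.2).

Fact dsum_comp_linear b : linear (dsum_comp b).
Proof. by move=> c u v; rewrite /dsum_comp /= !pcomp_linear. Qed.

Fact dsum_comp_comp b c w :
  dsum_comp b (dsum_comp c w) = if b == c then dsum_comp c w else 0.
Proof. by rewrite /dsum_comp /= !pcomp_comp; case: eqP. Qed.

Fact dsum_comp_sum w : dsum_comp false w + dsum_comp true w = w.
Proof. by case: w => u w; congr pair; rewrite pcomp_sum. Qed.

Definition dsum_space : superSpace F :=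
  SuperSpace dsum_comp_linear dsum_comp_comp dsum_comp_sum.

End DirectSum.

Record lieSuperalg (F : fieldType) := LieSuperalg {
  ls_space :> superSpace F;
  lie : ls_space -> ls_space -> ls_space;
  lie_linear_l : forall y, linear (lie^~ y);
  lie_linear_r : forall x, linear (lie x);
  lie_even : forall a b x y,
    homog a x -> homog b y -> homog (a (+) b) (lie x y);
  lie_antisym : forall a b x y, homog a x -> homog b y ->
    lie x y = - ((-1) ^+ (a && b) *: lie y x);
  lie_jacobi : forall a b x y z, homog a x -> homog b y ->
    lie x (lie y z) = lie (lie x y) z + (-1) ^+ (a && b) *: lie y (lie x z) }.

Section LieSuperalgTheory.
Variables (F : fieldType) (L : lieSuperalg F).

Definition subalgebra (K : gradedSub L) : Prop :=
  forall x y, x \in gs_pred K -> y \in gs_pred K -> lie x y \in gs_pred K.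

Definition abelian_sub (K : gradedSub L) : Prop :=
  forall x y, x \in gs_pred K -> y \in gs_pred K -> lie x y = 0.

Definition direct_decomposition (K V : gradedSub L) : Prop :=
  (forall x : L, exists k v : L,
     [/\ k \in gs_pred K, v \in gs_pred V & x = k + v]) /\
  (forall x : L, x \in gs_pred K -> x \in gs_pred V -> x = 0).

Definition is_projector (K V : gradedSub L) (P : L -> sub_space V) : Prop :=
  forall (k : L) (v : sub_space V), k \in gs_pred K -> P (k + val v) = v.

Definition odd_derivation (D : L -> L) : Prop :=
  [/\ linear D,
      (forall b x, homog b x -> homog (~~ b) (D x)) &
      (forall b x y, homog b x ->
         D (lie x y) = lie (D x) y + (-1) ^+ b *: lie x (D y))].

(* [... [[x, a_1], a_2], ..., a_n] for s = [:: a_1; ...; a_n]. *)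
Definition iter_lie (V : gradedSub L) (x : L) (s : seq (sub_space V)) : L :=
  foldl (@lie F L) x [seq val a | a <- s].

End LieSuperalgTheory.

Definition is_shuffle (n k : nat) (s : 'S_n) : bool :=
  [forall i : 'I_n, forall j : 'I_n,
     (i < j)%N && ((j < k)%N || (k <= i)%N) ==> (s i < s j)%N].

(* Exponent of the sign of the rearrangement w_(s 0), ..., w_(s (n-1)) of     *)
(* graded-commuting elements w_i of parities e i.                             *)
Definition koszul (n : nat) (e : 'I_n -> bool) (s : 'S_n) : nat :=
  (\sum_(i < n) \sum_(j < n | (i < j) && (s j < s i)) (e (s i) && e (s j)))%N.

(* A sequence of k-ary operations, k = 0, 1, 2, ..., is encoded as a single   *)
(* function on finite lists, whose restriction to lists of size k is the      *)
(* k-ary operation.                                                           *)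
Definition jacobiator (F : fieldType) (W : superSpace F) (br : seq W -> W)
    (n : nat) (e : 'I_n -> bool) (w : 'I_n -> W) : W :=
  \sum_(k < n.+1) \sum_(s : 'S_n | is_shuffle k s)
    let ws := [seq w (s i) | i <- enum 'I_n] in
    (-1) ^+ koszul e s *: br (br (take k ws) :: drop k ws).

Record linfty (F : fieldType) (W : superSpace F) := Linfty {
  br :> seq W -> W;
  br_multilinear : forall s1 s2 : seq W, linear (fun w => br (s1 ++ w :: s2));
  br_odd : forall n (e : 'I_n -> bool) (w : 'I_n -> W),
    (forall i, homog (e i) (w i)) ->
    homog (~~ odd (\sum_(i < n) e i)%N) (br [seq w i | i <- enum 'I_n]);
  br_sym : forall (s1 s2 : seq W) (a b : bool) (u v : W),
    homog a u -> homog b v ->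
    br (s1 ++ u :: v :: s2) = (-1) ^+ (a && b) *: br (s1 ++ v :: u :: s2);
  br_jacobi : forall n (e : 'I_n -> bool) (w : 'I_n -> W),
    (forall i, homog (e i) (w i)) -> jacobiator br e w = 0 }.

Section LinftyMaps.
Variables (F : fieldType) (X Y : superSpace F).
Variables (BX : linfty X) (BY : linfty Y).

Definition linfty_morphism (f : X -> Y) : Prop :=
  [/\ linear f,
      (forall b x, homog b x -> homog b (f x)) &
      (forall s, f (BX s) = BY (map f s))].

End LinftyMaps.

Section Cohomology.
Variables (F : fieldType) (X : superSpace F) (BX : linfty X).

Definition cocycle (x : X) : Prop := BX [:: x] = 0.

Definition cohomologous (x y : X) : Prop := exists z, x - y = BX [:: z].

End Cohomology.

(* Cohomology is the space of cocycles modulo [cohomologous]; the four last   *)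
(* clauses say that f induces a map on cohomology which is injective and      *)
(* surjective (for linear f it is then a linear isomorphism).                 *)
Definition quasi_isomorphism (F : fieldType) (X Y : superSpace F)
    (BX : linfty X) (BY : linfty Y) (f : X -> Y) : Prop :=
  [/\ linfty_morphism BX BY f, BX [::] = 0 & BY [::] = 0] /\
  [/\ (forall x, cocycle BX x -> cocycle BY (f x)),
      (forall x y, cohomologous BX x y -> cohomologous BY (f x) (f y)),
      (forall x y, cocycle BX x -> cocycle BX y ->
         cohomologous BY (f x) (f y) -> cohomologous BX x y) &
      (forall y, cocycle BY y ->
         exists2 x, cocycle BX x & cohomologous BY (f x) y)].

Definition cofibration (F : fieldType) (X Y : superSpace F)
    (BX : linfty X) (BY : linfty Y) (f : X -> Y) : Prop :=
  linfty_morphism BX BY f /\ injective f.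

Definition fibration (F : fieldType) (X Y : superSpace F)
    (BX : linfty X) (BY : linfty Y) (f : X -> Y) : Prop :=
  linfty_morphism BX BY f /\ (forall y, exists x, f x = y).

Definition is_cocylinder (F : fieldType) (X Y Z : superSpace F)
    (BX : linfty X) (BY : linfty Y) (BZ : linfty Z)
    (f : X -> Y) (j : X -> Z) (p : Z -> Y) : Prop :=
  [/\ f =1 p \o j, cofibration BX BZ j, quasi_isomorphism BX BZ j
    & fibration BZ BY p].

(* [iota] identifies the L_infinity-algebra V with Ker p, with the brackets   *)
(* restricted from Z.                                                         *)
Definition is_fiber (F : fieldType) (Y Z V : superSpace F)
    (BY : linfty Y) (BZ : linfty Z) (BV : linfty V)
    (p : Z -> Y) (iota : V -> Z) : Prop :=
  [/\ linfty_morphism BZ BY p, linfty_morphism BV BZ iota, injective iota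
    & forall z, p z = 0 <-> exists v, iota v = z].

Section Brackets.
Variables (F : fieldType) (L : lieSuperalg F).

(* Brackets on Pi L. *)
Definition dgla_brackets (D : L -> L) (B : linfty (Pi_space L)) : Prop :=
  [/\ B [::] = 0,
      (forall x : L, B [:: x] = - D x),
      (forall e (x y : L), homog e x -> B [:: x; y] = (-1) ^+ e *: lie x y) &
      (forall s, (2 < size s)%N -> B s = 0)].

(* Brackets on Pi K restricted from Pi L. *)
Definition restricted_brackets (K : gradedSub L) (BL : linfty (Pi_space L))
    (BK : linfty (Pi_space (sub_space K))) : Prop :=
  forall s : seq (sub_space K), val (BK s : sub_space K) = BL [seq val x | x <- s].

(* Brackets on V. *)
Definition derived_brackets (V : gradedSub L) (P : L -> sub_space V)
    (D : L -> L) (B : linfty (sub_space V)) : Prop :=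
  B [::] = 0 /\
  (forall (a : sub_space V) (s : seq (sub_space V)),
     B (a :: s) = P (iter_lie (D (val a)) s)).

(* Brackets on Pi L (+) V.  By symmetry and multilinearity every bracket of   *)
(* arity at least 3 reduces to those with at most one argument in Pi L, and   *)
(* those whose first two arguments are in Pi L, which vanish.                 *)
Definition cocylinder_brackets (V : gradedSub L) (P : L -> sub_space V)
    (D : L -> L) (B : linfty (dsum_space (Pi_space L) (sub_space V))) : Prop :=
  let inL (x : L) : dsum_space (Pi_space L) (sub_space V) := (x, 0) in
  let inV (a : sub_space V) : dsum_space (Pi_space L) (sub_space V) := (0, a) in
  [/\ B [::] = 0,
      (forall (x : L) (a : sub_space V),
         B [:: (x, a)] = (- D x, P (x + D (val a)))) &
      (forall e (x y : L), homog e x ->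
         B [:: inL x; inL y] = inL ((-1) ^+ e *: lie x y))] /\
  [/\ (forall (x : L) (s : seq (sub_space V)), s != [::] ->
         B (inL x :: map inV s) = inV (P (iter_lie x s))),
      (forall (a : sub_space V) (s : seq (sub_space V)),
         B (map inV (a :: s)) = inV (P (iter_lie (D (val a)) s))) &
      (forall (x y : L) s, s != [::] -> B [:: inL x, inL y & s] = 0)].

End Brackets.

Section Maps.
Variables (F : fieldType) (L : lieSuperalg F) (K V : gradedSub L).

Let PiL := Pi_space L.
Let PiK := Pi_space (sub_space K).
Let Z := dsum_space PiL (sub_space V).

Definition incl_map (x : PiK) : PiL := subsp_val x.
Definition cocyl_j (x : PiK) : Z := (incl_map x, 0).
Definition cocyl_p (w : Z) : PiL := w.1.
Definition fiber_map (a : sub_space V) : Z := (0, a).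

End Maps.

(* Main.v *)
Require Import Defs.
From HB Require Import structures.
From mathcomp Require Import all_boot all_order all_fingroup all_algebra ssrAC.

Set Implicit Arguments.
Unset Strict Implicit.
Unset Printing Implicit Defensive.

Import GRing.Theory.
Local Open Scope ring_scope.

(* Adjoin D to L as an odd element d, so that [d, x] = Dx and [d, d] = 0, and *)
(* extend P by P d = 0.  All brackets on Pi L (+) V are then the              *)
(* polarizations of the two components of the vector field                    *)
(*   Q(x, a) = (- [d + x, d + x] / 2, P exp(- ad a)(d + x)).                  *)
(* Put y = exp(- ad a)(d + x).  Since exp(- ad a) is an automorphism and V is *)
(* abelian, the V-component of Q^2 is - P[y, y] / 2 + P[y, P y], which        *)
(* vanishes because P[y - P y, y - P y] = 0 and [P y, P y] = 0; the           *)
(* L-component is the Jacobi identity.  The polarized identities are proved   *)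
(* by induction on the list of arguments: the Jacobiator is a sum over        *)
(* unshuffles, which satisfies a recursion when a list is extended by one     *)
(* element, namely the Leibniz rule of a convolution product.  The other      *)
(* three L_infinity-structures are retracts of this one.                      *)

(** * Sums over unshuffles *)

(** Once [d] is adjoined, [D] is the inner derivation [[d, -]], and all higher Jacobi identities on
    [Pi L (+) V] become one quadratic identity, split into two components. The component in [L]
    unites [D^2 = 0], the Leibniz rule and the Jacobi identity ([half_square_jacobi]). The component
    in [V] rests on two facts. Conjugation by [exp(- ad a)] carries [[d + x, d + x]] to [[y, y]]
    ([unshuffle_exp_exp]). For the odd element [y] one has [P[y, y] = 2 P[P y, y]], because [V] is
    abelian and the kernel of [P], spanned by [d] and [K], is a subalgebra ([derived_jacobi]). The
    passage from shuffle permutations to the recursive sums used in the inductions is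
    [jacobiator_unshuffle].

    The remaining structures come from that on [Pi L (+) V]. The images of [V] and of [j] are closed
    under its brackets, and the [L]-component of a bracket depends only on the [L]-components of its
    arguments; hence [j], [p] and the inclusion of [V] preserve all brackets.

    That [j] is a quasi-isomorphism is explicit. A cocycle [(x, a)] has [x + Da] in [K], and
    [j(x + Da) - (x, a)] is the differential of [(-a, 0)]. If [j] of an element of [Pi K] is the
    differential of [(z, a)], then [z + Da] lies in [K] and already bounds that element in
    [Pi K]. *)

Section LinearMaps.
Variables (F : fieldType) (U W : lmodType F) (f : U -> W).
Hypothesis lin_f : linear f.

Lemma linfD u v : f (u + v) = f u + f v.
Proof. by have := lin_f 1 u v; rewrite !scale1r. Qed.

Lemma linf0 : f 0 = 0.
Proof. by apply: (addIr (f 0)); rewrite add0r -linfD add0r. Qed.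

Lemma linfZ c u : f (c *: u) = c *: f u.
Proof. by have := lin_f c u 0; rewrite linf0 !addr0. Qed.

Lemma linfN u : f (- u) = - f u.
Proof. by rewrite -scaleN1r linfZ scaleN1r. Qed.

Lemma linfB u v : f (u - v) = f u - f v.
Proof. by rewrite linfD linfN. Qed.

End LinearMaps.

Section UnshuffleSum.
Variables (F : fieldType) (T : Type) (e : T -> bool).

Definition parity (l : seq T) : bool := foldr (fun t b => e t (+) b) false l.

(** Each entry joins the first or the second sublist. In the second case it has to pass all of [l1],
    whose entries come after it in the list; this is the sign. *)
Fixpoint unshuffle_sum (M : lmodType F) (l : seq T) (f : seq T -> seq T -> M) : M :=
  if l is t :: l' then
    unshuffle_sum l' (fun l1 l2 => f (t :: l1) l2) +
    unshuffle_sum l'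
      (fun l1 l2 => (-1) ^+ (e t && parity l1) *: f l1 (t :: l2))
  else f [::] [::].

Variables (M : lmodType F).
Implicit Types (f g : seq T -> seq T -> M) (l : seq T).

Lemma eq_unshuffle_sum l f g :
  (forall l1 l2, f l1 l2 = g l1 l2) -> unshuffle_sum l f = unshuffle_sum l g.
Proof.
elim: l f g => [|t l IHl] f g fg /=; first exact: fg.
by congr (_ + _); apply: IHl => l1 l2; rewrite fg.
Qed.

Lemma unshuffle_sum_cons t l f :
  unshuffle_sum (t :: l) f =
  unshuffle_sum l (fun l1 l2 => f (t :: l1) l2) +
  unshuffle_sum l (fun l1 l2 => (-1) ^+ (e t && parity l1) *: f l1 (t :: l2)).
Proof. by []. Qed.

Lemma parity_cons t l : parity (t :: l) = e t (+) parity l.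
Proof. by []. Qed.

Lemma unshuffle_sumD l f g :
  unshuffle_sum l (fun l1 l2 => f l1 l2 + g l1 l2) =
  unshuffle_sum l f + unshuffle_sum l g.
Proof.
elim: l f g => [|t l IHl] f g //=.
rewrite [RHS]addrACA -[X in _ = X + _]IHl -[X in _ = _ + X]IHl; congr (_ + _).
by apply: eq_unshuffle_sum => l1 l2; rewrite scalerDr.
Qed.

End UnshuffleSum.

Lemma unshuffle_sum_map (F : fieldType) (T : Type) (e : T -> bool)
    (M N : lmodType F) (h : M -> N) l (f : seq T -> seq T -> M) :
  linear h ->
  h (unshuffle_sum e l f) = unshuffle_sum e l (fun l1 l2 => h (f l1 l2)).
Proof.
move=> lin_h; elim: l f => [|t l IHl] f //=.
rewrite linfD // !IHl; congr (_ + _).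
by apply: eq_unshuffle_sum => l1 l2; rewrite linfZ.
Qed.

Section UnshuffleSumTheory.
Variables (F : fieldType) (T : Type) (e : T -> bool) (M : lmodType F).
Implicit Types (f g : seq T -> seq T -> M) (l : seq T).

Local Notation parity := (parity e).
Local Notation unshuffle_sum := (unshuffle_sum e).

Lemma unshuffle_sumZ c l f :
  unshuffle_sum l (fun l1 l2 => c *: f l1 l2) = c *: unshuffle_sum l f.
Proof.
rewrite (@unshuffle_sum_map _ _ _ _ _ ( *:%R c)) // => b u v.
by rewrite scalerDr !scalerA mulrC.
Qed.

Lemma unshuffle_sum0 l : unshuffle_sum l (fun _ _ => 0 : M) = 0.
Proof.
by rewrite -[RHS](scale0r (unshuffle_sum l (fun _ _ => 0 : M))) -unshuffle_sumZ scaler0.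
Qed.

Lemma unshuffle_sum_nil l (h : seq T -> M) :
  unshuffle_sum l (fun l1 l2 => if l1 is [::] then h l2 else 0) = h l.
Proof.
elim: l h => [|t l IHl] h //=; rewrite unshuffle_sum0 add0r -[RHS](IHl (h \o cons t)).
by apply: eq_unshuffle_sum => -[|u l1] l2; rewrite ?scaler0 // andbF scale1r.
Qed.

(** Graded commutativity of the convolution: exchanging the two blocks costs the product of their
    parities. *)
Lemma unshuffle_sum_swap l f :
  unshuffle_sum l f =
  unshuffle_sum l (fun l1 l2 => (-1) ^+ (parity l1 && parity l2) *: f l2 l1).
Proof.
elim: l f => [|t l IHl] f /=; first by rewrite scale1r.
rewrite IHl [X in _ + X]IHl addrC; congr (_ + _);
  apply: eq_unshuffle_sum => l1 l2; rewrite !scalerA -!signr_addb; congr (_ ^+ _ *: _);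
  by case: (e t) (parity l1) (parity l2) => [] [] [].
Qed.

End UnshuffleSumTheory.

(** * Shuffle permutations, subsets and unshuffles *)

Section JacobiatorUnshuffle.
Variables (n : nat) (e : 'I_n -> bool).
Implicit Types (A : {set 'I_n}) (l : seq 'I_n).

Let ltI (i j : 'I_n) := (i < j)%N.

Let ltI_trans : transitive ltI. Proof. by move=> ? ? ?; apply: ltn_trans. Qed.

Let ltI_irr : irreflexive ltI. Proof. by move=> i; rewrite /ltI ltnn. Qed.

(** The Koszul exponent for moving the entries of [A] to the front: it counts the pairs of odd
    entries that change order. *)
Definition crossings A l : nat :=
  (\sum_(p <- l | p \in A) \sum_(q <- l | (q \notin A) && (q < p)) (e p && e q))%N.

(** An unshuffle is determined by the set of entries in its first block. Splitting the subsets of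
    [t :: l] according to whether they contain [t] gives the two terms of the recursion. *)
Lemma unshuffle_sum_subsets (F : fieldType) (M : lmodType F)
    (f : seq 'I_n -> seq 'I_n -> M) l : sorted ltI l ->
  unshuffle_sum e l f =
  \sum_(A : {set 'I_n} | A \subset l) (-1) ^+ crossings A l *:
    f [seq i <- l | i \in A] [seq i <- l | i \notin A].
Proof.
elim: l f => [|t l IHl] f sl /=.
  have s0 : (set0 : {set 'I_n}) \subset ([::] : seq 'I_n).
    by apply/subsetP => i; rewrite inE.
  rewrite (bigD1 set0) //= big1 => [|A /andP[sA /negP[]]].
    by rewrite /crossings !big_nil scale1r addr0.
  by apply/eqP/setP => i; rewrite inE; apply/negP => /(subsetP sA).
have ltl : forall i, i \in l -> (t < i)%N.
  by move: sl; rewrite /= (path_sortedE ltI_trans) => /andP[/allP].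
have tl : t \notin l by apply/negP => /ltl; rewrite ltnn.
have {}sl : sorted ltI l by apply: path_sorted sl.
rewrite (bigID (fun A => t \in A)) /=; congr (_ + _).
  rewrite IHl // [RHS](reindex_onto (fun A => t |: A) (fun A => A :\ t)) /=; last first.
    by move=> A /andP[_ tA]; rewrite setD1K.
  have subE A : (t |: A \subset t :: l) && (t \in t |: A) && ((t |: A) :\ t == A) =
               (A \subset l).
    rewrite setU11 andbT; apply/idP/subsetP => [/andP[/subsetP sA /eqP <-] i|sA].
      rewrite !inE => /andP[/negPf ti iA].
      by have := sA i; rewrite !inE ti /= in iA *; apply.
    apply/andP; split; first by apply/subsetP => i; rewrite !inE; case: eqP => //= _; apply: sA.
    by rewrite setU1K //; apply/negP => /sA; apply/negP.
  apply: eq_big => [A|A sA]; first by rewrite subE.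
  have inA i : i \in l -> (i \in t |: A) = (i \in A).
    by move=> il; rewrite !inE; case: eqP => // ti; rewrite -ti il in tl.
  rewrite setU11 /=; congr (_ ^+ _ *: f (_ :: _) _).
  - rewrite /crossings big_cons setU11 big_cons setU11 /=.
    (* No entry of [l] is smaller than [t], so [t] crosses nothing when it goes to the first
       block. *)
    rewrite [X in (X + _)%N]big_seq_cond [X in (X + _)%N]big_pred0 => [|q]; last first.
      by case: (boolP (q \in l)) => // /ltl ?; rewrite ltnNge ltnW // andbF.
    rewrite add0n big_seq_cond [RHS]big_seq_cond; apply: eq_big => [p|p /andP[pl _]].
      by case: (boolP (p \in l)) => // pl; rewrite inA.
    rewrite big_cons setU11 /= big_seq_cond [RHS]big_seq_cond; apply: eq_bigl => q.
    by case: (boolP (q \in l)) => // ql; rewrite inA.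
  - by apply: eq_in_filter => i il; rewrite inA.
  - by apply: eq_in_filter => i il; rewrite inA.
rewrite IHl //; apply: eq_big => [A|A sA].
  apply/subsetP/idP => [sA|/andP[/subsetP sA tA] i iA].
    apply/andP.
    split; last by apply/negP => /sA; apply/negP.
    by apply/subsetP => i /sA il; rewrite inE il orbT.
  by have := sA i iA; rewrite inE; case: eqP => // it _; rewrite -it iA in tA.
have tA : t \notin A by apply: contra tl; apply: (subsetP sA).
rewrite (negPf tA) /= scalerA; congr (_ *: _).
rewrite -signr_odd -signr_addb -[RHS]signr_odd; congr (_ ^+ _).
rewrite /crossings big_cons (negPf tA).
(* Outside [A], the entry [t] is crossed by every element of [A]; the extra summand yields the sign
   [e t && parity l1]. *)
have -> : (\sum_(p <- l | p \in A)
             \sum_(q <- t :: l | (q \notin A) && (q < p)) (e p && e q) =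
           \sum_(p <- l | p \in A) ((e p && e t) +
             \sum_(q <- l | (q \notin A) && (q < p)) (e p && e q)))%N.
  rewrite big_seq_cond [RHS]big_seq_cond; apply: eq_bigr => p /andP[/ltl tp _].
  by rewrite big_cons tA tp.
rewrite big_split /= oddD addbC; congr (_ (+) _).
rewrite /parity; elim: (l) => [|p l' IH] /=; first by rewrite big_nil andbF.
rewrite big_cons; case: (p \in A); rewrite //= oddD -IH /=.
by case: (e t) (e p) (foldr _ _ _) => [] [] [].
Qed.

Lemma sorted_filter_enum (a : pred 'I_n) : sorted ltI (filter a (enum 'I_n)).
Proof.
apply: sorted_filter => //.
by have := iota_ltn_sorted 0 n; rewrite -val_enum_ord sorted_map.
Qed.

Lemma sorted_map_perm (s : 'S_n) (a : pred 'I_n) :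
  (forall i j, a i -> a j -> (i < j)%N -> (s i < s j)%N) ->
  sorted ltI [seq s i | i <- enum 'I_n & a i].
Proof.
move=> mono_s; apply: (homo_sorted_in (P := a) (e := ltI)); rewrite ?filter_all //.
exact: sorted_filter_enum.
Qed.

Lemma take_enum_ord k : (k <= n)%N ->
  (take k (enum 'I_n) = [seq i : 'I_n <- enum 'I_n | (i < k)%N]) *
  (drop k (enum 'I_n) = [seq i : 'I_n <- enum 'I_n | ~~ (i < k)%N]).
Proof.
move=> kn.
have lo : all (fun i => (i < k)%N) (iota 0 k) by apply/allP => i; rewrite mem_iota.
have hi : all (fun i => ~~ (i < k)%N) (iota k (n - k)).
  by apply/allP => i; rewrite mem_iota -leqNgt => /andP[].
have e0 : iota 0 n = iota 0 k ++ iota k (n - k) by rewrite -iotaD subnKC.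
split; apply: (inj_map val_inj).
  rewrite map_take -(filter_map val (fun i => (i < k)%N)) val_enum_ord e0.
  rewrite take_size_cat ?size_iota // filter_cat (all_filterP lo).
  rewrite (eq_in_filter (a2 := pred0) (s := iota k _)) ?filter_pred0 ?cats0 //.
  by move=> i /(allP hi) /negPf.
rewrite map_drop -(filter_map val (fun i => ~~ (i < k)%N)) val_enum_ord e0.
rewrite drop_size_cat ?size_iota // filter_cat (all_filterP hi).
rewrite (eq_in_filter (a2 := pred0) (s := iota 0 _)) ?filter_pred0 //.
by move=> i /(allP lo) ->.
Qed.

(** A shuffle is increasing on each block, and an increasing list is determined by its set of
    entries. *)
Lemma shuffle_enum k (s : 'S_n) : (k <= n)%N -> is_shuffle k s ->
  let A := [set s i | i : 'I_n & (i < k)%N] in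
  (take k [seq s i | i <- enum 'I_n] = [seq i <- enum 'I_n | i \in A]) *
  (drop k [seq s i | i <- enum 'I_n] = [seq i <- enum 'I_n | i \notin A]).
Proof.
move=> kn /forallP sh A.
have sP (i j : 'I_n) : (i < j)%N -> (j < k)%N || (k <= i)%N -> (s i < s j)%N.
  by move=> ij jk; have /forallP/(_ j)/implyP := sh i; rewrite ij => ->.
have sA (i : 'I_n) : (s i \in A) = (i < k)%N.
  by rewrite mem_imset ?inE //; apply: perm_inj.
rewrite -map_take -map_drop !take_enum_ord //.
split; apply: (irr_sorted_eq ltI_trans ltI_irr); try exact: sorted_filter_enum.
- by apply: sorted_map_perm => i j /= ik jk ij; apply: sP => //; rewrite jk.
- move=> i; rewrite -[i](permKV s) mem_map; last exact: perm_inj.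
  by rewrite [LHS]mem_filter [RHS]mem_filter sA !mem_enum.
- apply: sorted_map_perm => i j /=; rewrite -!leqNgt => ki kj ij.
  by apply: sP => //; rewrite ki orbT.
- move=> i; rewrite -[i](permKV s) mem_map; last exact: perm_inj.
  by rewrite [LHS]mem_filter [RHS]mem_filter sA !mem_enum.
Qed.

(** Within a block a shuffle has no inversions, so only pairs from different blocks contribute. *)
Lemma koszul_shuffle k (s : 'S_n) : is_shuffle k s ->
  koszul e s = crossings [set s i | i : 'I_n & (i < k)%N] (enum 'I_n).
Proof.
move=> /forallP sh; set A := imset _ _.
have sP (i j : 'I_n) : (i < j)%N -> (j < k)%N || (k <= i)%N -> (s i < s j)%N.
  by move=> ij jk; have /forallP/(_ j)/implyP := sh i; rewrite ij => ->.
have sA (i : 'I_n) : (s i \in A) = (i < k)%N.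
  by rewrite mem_imset ?inE //; apply: perm_inj.
rewrite /koszul /crossings [RHS]big_enum_cond [RHS](reindex_inj (@perm_inj _ s)) /=.
rewrite [RHS]big_mkcond; apply: eq_bigr => i _; rewrite sA.
rewrite [in RHS]big_enum_cond [in RHS](reindex_inj (@perm_inj _ s)) /=.
case: ltnP => ik.
  apply: eq_bigl => j; rewrite sA -leqNgt; case: (leqP k j) => kj /=.
    by rewrite (leq_trans ik kj).
  apply/negP => /andP[ij]; rewrite ltnNge => /negP[].
  by apply: ltnW; apply: sP => //; rewrite kj.
rewrite big_pred0 // => j; apply/negP => /andP[ij]; rewrite ltnNge => /negP[].
by apply: ltnW; apply: sP => //; rewrite ik orbT.
Qed.

Definition split_seq A := [seq i <- enum 'I_n | i \in A] ++ [seq i <- enum 'I_n | i \notin A].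

Fact size_split_seq A : size (split_seq A) == n.
Proof. by rewrite size_cat !size_filter count_predC size_enum_ord. Qed.

Fact split_seq_inj A : injective (tnth (Tuple (size_split_seq A))).
Proof.
apply/tuple_uniqP; rewrite /= /split_seq.
suff /perm_uniq -> : perm_eq (split_seq A) (enum 'I_n) by apply: enum_uniq.
by apply/permPl; apply: perm_filterC.
Qed.

Definition unsplit_perm A : 'S_n := perm (@split_seq_inj A).

Lemma map_unsplit_perm A : [seq unsplit_perm A i | i <- enum 'I_n] = split_seq A.
Proof.
rewrite -[RHS](map_tnth_enum (Tuple (size_split_seq A))).
by apply: eq_map => i; rewrite permE.
Qed.

Lemma size_filter_mem A : size [seq i <- enum 'I_n | i \in A] = #|A|.
Proof. by rewrite size_filter -sum1_count big_enum_cond sum1_card. Qed.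

(** The left-hand side has the form of the condition left by [reindex_onto] when shuffles are
    parametrized by the image of their first block. *)
Lemma unsplit_perm_shuffle k A : (k <= n)%N ->
  is_shuffle k (unsplit_perm A) &&
    ([set unsplit_perm A i | i : 'I_n & (i < k)%N] == A) = (#|A| == k).
Proof.
move=> kn; have card_lt : #|[set i : 'I_n | (i < k)%N]| = k.
  rewrite -size_filter_mem (eq_filter (a2 := fun i : 'I_n => (i < k)%N)); last first.
    by move=> i; rewrite inE.
  by rewrite -(take_enum_ord kn).1 size_takel // size_enum_ord.
apply/andP/eqP => [[_ /eqP <-]|cA].
  by rewrite card_imset //; apply: perm_inj.
have permA (x0 i : 'I_n) : unsplit_perm A i =
    if (i < k)%N then nth x0 [seq i <- enum 'I_n | i \in A] i
    else nth x0 [seq i <- enum 'I_n | i \notin A] (i - k).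
  by rewrite permE (tnth_nth x0) /= nth_cat size_filter_mem cA.
have sz2 : size [seq i <- enum 'I_n | i \notin A] = (n - k)%N.
  have /eqP := size_split_seq A; rewrite size_cat size_filter_mem cA => cn.
  by apply: (@addnI k); rewrite cn subnKC.
split.
  apply/forallP => i; apply/forallP => j; apply/implyP => /andP[ij].
  rewrite !(permA i); case: ltnP => [jk _|kj /= ki].
    rewrite (ltn_trans ij jk).
    apply: (sorted_ltn_nth ltI_trans i (sorted_filter_enum _)) => //;
      by rewrite inE size_filter_mem cA // (ltn_trans ij).
  have -> : (i < k)%N = false by rewrite ltnNge ki.
  apply: (sorted_ltn_nth ltI_trans i (sorted_filter_enum _)) => //.
  - by rewrite inE sz2 ltn_sub2r // (leq_ltn_trans ki).
  - by rewrite inE sz2 ltn_sub2r // (leq_ltn_trans kj).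
  - by rewrite ltn_sub2r // (leq_ltn_trans ki).
rewrite eqEcard card_imset ?card_lt ?cA ?leqnn ?andbT; last exact: perm_inj.
apply/subsetP => _ /imsetP[i ik ->]; rewrite inE in ik; rewrite (permA i) ik.
have : nth i [seq i <- enum 'I_n | i \in A] i \in [seq i <- enum 'I_n | i \in A].
  by apply: mem_nth; rewrite size_filter_mem cA.
by rewrite mem_filter => /andP[].
Qed.

(** Subsets are grouped by cardinality [k], and those with [k] elements are in bijection with the
    shuffles for [k]. From here on Jacobiators are handled by induction on a list. *)
Lemma jacobiator_unshuffle (F : fieldType) (W : superSpace F) (br : seq W -> W)
    (w : 'I_n -> W) :
  jacobiator br e w = unshuffle_sum e (enum 'I_n)
    (fun l1 l2 => br (br [seq w i | i <- l1] :: [seq w i | i <- l2])).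
Proof.
rewrite unshuffle_sum_subsets; last first.
  by rewrite -[enum _]filter_predT; apply: sorted_filter_enum.
rewrite (partition_big (fun A => inord #|A| : 'I_n.+1) predT) //=.
apply: eq_bigr => k _; have kn : (k <= n)%N by rewrite -ltnS.
rewrite (reindex_onto unsplit_perm (fun s => [set s i | i : 'I_n & (i < k)%N])) /=.
  apply: eq_big => A.
    rewrite unsplit_perm_shuffle // -val_eqE /= inordK; last first.
      by rewrite ltnS -[X in (_ <= X)%N]card_ord max_card.
    have -> : A \subset enum 'I_n by apply/subsetP => i; rewrite mem_enum.
    by [].
  move=> /andP[sh /eqP imA].
  have := shuffle_enum kn sh; rewrite imA => -[e1 e2].
  rewrite (koszul_shuffle sh) imA -e1 -e2 -!map_take -!map_drop.
  by rewrite -!map_comp.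
move=> s sh; apply/permP => i.
have [e1 e2] := shuffle_enum kn sh.
have : [seq s i | i <- enum 'I_n] =
    [seq unsplit_perm [set s i | i : 'I_n & (i < k)%N] i | i <- enum 'I_n].
  by rewrite map_unsplit_perm /split_seq -e1 -e2 cat_take_drop.
by move/eq_in_map => ->; rewrite ?mem_enum.
Qed.

End JacobiatorUnshuffle.

(** * Higher derived brackets of an odd element *)

Section SuperSpaceTheory.
Variables (F : fieldType) (W : superSpace F).
Implicit Types (u v : W).

Lemma homog0 b : homog b (0 : W).
Proof. exact: linf0 (@Defs.pcomp_linear F W b). Qed.

Lemma homogD b u v : homog b u -> homog b v -> homog b (u + v).
Proof. by rewrite /homog (linfD (@Defs.pcomp_linear F W b)) => -> ->. Qed.

Lemma homogZ b c u : homog b u -> homog b (c *: u).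
Proof. by rewrite /homog (linfZ (@Defs.pcomp_linear F W b)) => ->. Qed.

Lemma homogN b u : homog b u -> homog b (- u).
Proof. by rewrite -scaleN1r; apply: homogZ. Qed.

Lemma homogB b u v : homog b u -> homog b v -> homog b (u - v).
Proof. by move=> hu hv; apply/homogD/homogN. Qed.

Lemma homog_pcomp b u : homog b (Defs.pcomp b u).
Proof. by rewrite /homog pcomp_comp eqxx. Qed.

(** The parity involution. Being linear, it expresses a sign depending on the parity of [u] without
    assuming [u] homogeneous, which keeps the brackets below multilinear on the whole space. *)
Definition grading_sign u : W := Defs.pcomp false u - Defs.pcomp true u.

Lemma grading_sign_linear : linear grading_sign.
Proof.
move=> c u v; rewrite /grading_sign !pcomp_linear scalerBr opprD.
by rewrite addrACA.
Qed.

Lemma grading_signE b u : homog b u -> grading_sign u = (-1) ^+ b *: u.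
Proof.
move=> hu; rewrite /grading_sign -hu !pcomp_comp.
by case: b hu => /= hu; rewrite ?sub0r ?subr0 ?scale1r ?scaleN1r.
Qed.

Lemma homog_grading_sign b u : homog b u -> homog b (grading_sign u).
Proof. by move=> hu; rewrite (grading_signE hu); apply: homogZ. Qed.

Lemma grading_signK : involutive grading_sign.
Proof.
move=> u; rewrite {2}/grading_sign (linfB grading_sign_linear).
rewrite !(grading_signE (homog_pcomp _ _)) scale1r scaleN1r opprK.
exact: pcomp_sum.
Qed.

Lemma homog_ind (Q : W -> Prop) :
  (forall u v, Q u -> Q v -> Q (u + v)) -> (forall b u, homog b u -> Q u) ->
  forall u, Q u.
Proof.
by move=> QD Qh u; rewrite -(pcomp_sum u); apply: QD; apply/Qh/homog_pcomp.
Qed.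

End SuperSpaceTheory.

Section LieTheory.
Variables (F : fieldType) (M : lieSuperalg F).
Implicit Types (x y z : M).

Lemma lieDl x y z : lie (x + y) z = lie x z + lie y z.
Proof. exact: (linfD (lie_linear_l z)). Qed.
Lemma lieDr x y z : lie x (y + z) = lie x y + lie x z.
Proof. exact: (linfD (lie_linear_r x)). Qed.
Lemma lieNl x y : lie (- x) y = - lie x y.
Proof. exact: (linfN (lie_linear_l y)). Qed.
Lemma lieNr x y : lie x (- y) = - lie x y.
Proof. exact: (linfN (lie_linear_r x)). Qed.
Lemma lieZl c x y : lie (c *: x) y = c *: lie x y.
Proof. exact: (linfZ (lie_linear_l y)). Qed.
Lemma lieZr c x y : lie x (c *: y) = c *: lie x y.
Proof. exact: (linfZ (lie_linear_r x)). Qed.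
Lemma lie0l x : lie 0 x = 0.
Proof. exact: (linf0 (lie_linear_l x)). Qed.
Lemma lie0r x : lie x 0 = 0.
Proof. exact: (linf0 (lie_linear_r x)). Qed.

Definition lieE := (lieDl, lieDr, lieNl, lieNr, lieZl, lieZr, lie0l, lie0r).

End LieTheory.

(** * Polarized brackets: multilinearity and symmetry *)

Section DerivedBrackets.
Variables (F : fieldType) (W : superSpace F) (M : lieSuperalg F).
Variables (xi al : W -> M) (d : M).
Hypotheses (xi_linear : linear xi) (al_linear : linear al).
Hypothesis xi_odd : forall b w, homog b w -> homog (~~ b) (xi w).
Hypothesis al_even : forall b w, homog b w -> homog b (al w).
Hypothesis al_abelian : forall u v, lie (al u) (al v) = 0.
Hypothesis d_odd : homog true d.
Implicit Types (x y z : M) (u v w : W) (s : seq W).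

Local Notation gam := (@grading_sign F M).

Definition iter_ad x s : M := foldl (fun y w => lie y (al w)) x s.

(* The polarization of [exp (- ad a) (d + x)], with [x = xi w] and            *)
(* [a = al w].                                                                *)
Fixpoint exp_ad s : M :=
  if s is w :: s' then iter_ad (xi w) s' - lie (gam (al w)) (exp_ad s') else d.

(* The polarization of [d + x]. *)
Definition shifted s : M :=
  match s with [::] => d | [:: w] => xi w | _ => 0 end.

(* The polarization of [- [d + x, d + x] / 2]. *)
Definition half_square s : M :=
  if s is w :: s' then lie (gam (xi w)) (shifted s') else 0.

Lemma gam_linear : linear gam. Proof. exact: grading_sign_linear. Qed.

Lemma iter_ad_linear s : linear (iter_ad^~ s).
Proof.
elim: s => [|w s IHs] c x y //=.
by rewrite -IHs /= lieDl lieZl.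
Qed.

Lemma iter_ad0 s : iter_ad 0 s = 0.
Proof. exact: linf0 (iter_ad_linear s). Qed.

Lemma iter_ad_cat x s1 s2 : iter_ad x (s1 ++ s2) = iter_ad (iter_ad x s1) s2.
Proof. exact: foldl_cat. Qed.

Lemma iter_ad_multilinear x s1 s2 : linear (fun w => iter_ad x (s1 ++ w :: s2)).
Proof.
move=> c u v; rewrite !iter_ad_cat /= -iter_ad_linear.
by rewrite al_linear lieDr lieZr.
Qed.

Lemma exp_ad_multilinear s1 s2 : linear (fun w => exp_ad (s1 ++ w :: s2)).
Proof.
elim: s1 => [|w s1 IHs] c u v /=.
  rewrite xi_linear iter_ad_linear al_linear gam_linear lieDl lieZl.
  by rewrite scalerBr opprD addrACA.
by rewrite iter_ad_multilinear IHs lieDr lieZr scalerBr opprD addrACA.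
Qed.

Lemma shifted_multilinear s1 s2 : linear (fun w => shifted (s1 ++ w :: s2)).
Proof.
move=> c u v; case: s1 => [|w [|w' s1]] /=; rewrite ?scaler0 ?addr0 //.
by case: s2 => [|w s2]; rewrite ?scaler0 ?addr0 //; apply: xi_linear.
Qed.

Lemma half_square_multilinear s1 s2 : linear (fun w => half_square (s1 ++ w :: s2)).
Proof.
move=> c u v; case: s1 => [|w s1] /=.
  by rewrite xi_linear gam_linear lieDl lieZl.
by rewrite shifted_multilinear lieDr lieZr.
Qed.

(* Jacobi identity for [al w], [z], [al v], where [al w] and [al v] commute. *)
Lemma lie_al_assoc w z v : lie (lie (al w) z) (al v) = lie (al w) (lie z (al v)).
Proof.
elim/homog_ind: w => [u w IHu IHw|a w hw].
  by rewrite (linfD al_linear) !lieDl IHu IHw.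
elim/homog_ind: z => [y z IHy IHz|b z hz]; first by rewrite !lieE IHy IHz.
by rewrite (lie_jacobi _ (al_even hw) hz) al_abelian lie0r scaler0 addr0.
Qed.

Lemma iter_ad_lie_al w z s : iter_ad (lie (al w) z) s = lie (al w) (iter_ad z s).
Proof. by elim: s z => //= v s IHs z; rewrite lie_al_assoc IHs. Qed.

(** The operators [ad (al w)] commute up to sign, so the innermost bracket can be made the
    outermost. In this form [iter_ad] and [exp_ad] both lose their first argument by peeling off
    [ad (al w)] from the outside. *)
Lemma iter_ad_cons b c x w s : homog b x -> homog c w ->
  iter_ad x (w :: s) = - ((-1) ^+ (b && c) *: lie (al w) (iter_ad x s)).
Proof.
move=> hx hw /=; rewrite (lie_antisym hx (al_even hw)).
by rewrite (linfN (iter_ad_linear s)) (linfZ (iter_ad_linear s)) iter_ad_lie_al.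
Qed.

Lemma lie_alC a b u v z : homog a u -> homog b v ->
  lie (al u) (lie (al v) z) = (-1) ^+ (a && b) *: lie (al v) (lie (al u) z).
Proof.
move=> hu hv; rewrite (lie_jacobi _ (al_even hu) (al_even hv)).
by rewrite al_abelian lie0l add0r.
Qed.

Lemma iter_ad_sym x s1 s2 a b u v : homog a u -> homog b v ->
  iter_ad x (s1 ++ u :: v :: s2) = (-1) ^+ (a && b) *: iter_ad x (s1 ++ v :: u :: s2).
Proof.
move=> hu hv; rewrite !iter_ad_cat /=; move: (iter_ad x s1) => y.
rewrite -(linfZ (iter_ad_linear s2)); congr iter_ad.
elim/homog_ind: y => [y z IHy IHz|c y hy]; first by rewrite !lieE IHy IHz scalerDr.
have E c' a' u' y' : homog c' y' -> homog a' u' -> lie y' (al u') =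
    - ((-1) ^+ (c' && a') *: lie (al u') y').
  by move=> h1 h2; apply: lie_antisym => //; apply: al_even.
rewrite (E _ _ _ _ hy hu) (E _ _ _ _ hy hv) !lieE.
rewrite !lie_al_assoc (E _ _ _ _ hy hu) (E _ _ _ _ hy hv).
rewrite !lieE (lie_alC _ hu hv) !scalerN !scalerA -!signr_addb.
by case: a b c {hu hv hy E} => [] [] [].
Qed.

Lemma al_grading_sign w : al (grading_sign w) = gam (al w).
Proof.
elim/homog_ind: w => [u v IHu IHv|b u hu].
  rewrite (linfD (@grading_sign_linear F W)) (linfD al_linear (grading_sign u)).
  by rewrite IHu IHv (linfD al_linear) (linfD gam_linear).
by rewrite (grading_signE hu) (grading_signE (al_even hu)) (linfZ al_linear).
Qed.

Lemma lie_odd_l x y : homog true x -> lie x y = - lie (gam y) x.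
Proof.
move=> hx; elim/homog_ind: y => [u v IHu IHv|b u hu].
  by rewrite lieDr IHu IHv (linfD gam_linear) lieDl opprD.
by rewrite (grading_signE hu) lieZl (lie_antisym hx hu).
Qed.

(** The sign in [exp_ad] is exactly that of moving [al w] past the odd [d], so on arguments from [V]
    the usual higher derived brackets of [d] come out. *)
Lemma exp_ad_xi0 (T : Type) (f : T -> W) (s : seq T) :
  (forall t, xi (f t) = 0) -> exp_ad (map f s) = iter_ad d (map f s).
Proof.
move=> xi0; elim: s => // t s IHs; rewrite map_cons.
rewrite -[RHS]/(iter_ad (lie d (al (f t))) (map f s)) [LHS]/=.
rewrite xi0 iter_ad0 sub0r IHs (lie_odd_l _ d_odd) (linfN (iter_ad_linear _)).
by rewrite -al_grading_sign iter_ad_lie_al.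
Qed.

Lemma exp_ad_cons a w s : homog a w ->
  exp_ad (w :: s) = iter_ad (xi w) s - (-1) ^+ a *: lie (al w) (exp_ad s).
Proof. by move=> hw /=; rewrite (grading_signE (al_even hw)) lieZl. Qed.

Lemma exp_ad_sym s1 s2 a b u v : homog a u -> homog b v ->
  exp_ad (s1 ++ u :: v :: s2) = (-1) ^+ (a && b) *: exp_ad (s1 ++ v :: u :: s2).
Proof.
move=> hu hv; elim: s1 => [|w s1 IHs]; last first.
  by rewrite /= IHs (iter_ad_sym _ _ _ hu hv) scalerBr lieZr.
rewrite !cat0s !(exp_ad_cons _ hu, exp_ad_cons _ hv).
rewrite (iter_ad_cons _ (xi_odd hu) hv) (iter_ad_cons _ (xi_odd hv) hu).
rewrite !lieE (lie_alC _ hu hv) !(scalerBr, scalerN, scalerA) -!signr_addb !opprB.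
move: (lie (al v) (lie _ _)) (lie (al u) (iter_ad _ _)) (lie _ (iter_ad _ _)) => x y z.
by rewrite addrCA [RHS]addrCA; case: a b {hu hv} => [] [];
  rewrite /= ?(scale1r, scaleN1r, opprK) //; congr (_ + _); rewrite addrC.
Qed.

Lemma shifted_large s1 u v s2 : shifted (s1 ++ u :: v :: s2) = 0.
Proof. by case: s1 => [|w [|w' s1]]. Qed.

Lemma half_square_sym s1 s2 a b u v : homog a u -> homog b v ->
  half_square (s1 ++ u :: v :: s2) =
  (-1) ^+ (a && b) *: half_square (s1 ++ v :: u :: s2).
Proof.
move=> hu hv; case: s1 => [|w s1] /=; last by rewrite !shifted_large lie0r scaler0.
case: s2 => [|w s2]; last by rewrite !lie0r scaler0.
rewrite (grading_signE (xi_odd hu)) (grading_signE (xi_odd hv)) !lieE.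
rewrite (lie_antisym (xi_odd hu) (xi_odd hv)) scalerN !scalerA -!signr_addb.
by case: a b {hu hv} => [] []; rewrite /= ?(scale1r, scaleN1r, opprK).
Qed.

(** * Quadratic identities as sums over unshuffles *)

Section Unshuffles.
Variables (T : Type) (e : T -> bool) (w : T -> W).
Hypothesis hw : forall t, homog (e t) (w t).
Implicit Types (t : T) (l : seq T).

Local Notation parity := (parity e).
Local Notation unshuffle_sum := (unshuffle_sum e).

Lemma homog_iter_ad b x l : homog b x -> homog (b (+) parity l) (iter_ad x (map w l)).
Proof.
elim: l b x => [|t l IHl] b x hx /=; first by rewrite addbF.
by rewrite addbA; apply: IHl; apply: lie_even => //; apply/al_even/hw.
Qed.

Lemma homog_exp_ad l : homog (~~ parity l) (exp_ad (map w l)).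
Proof.
elim: l => [|t l IHl] //=; apply: homogB.
  rewrite -addNb; exact: homog_iter_ad (xi_odd (hw t)).
rewrite -addbN; apply: lie_even IHl.
exact/homog_grading_sign/al_even/hw.
Qed.

Lemma homog_shifted l : homog (~~ parity l) (shifted (map w l)).
Proof.
case: l => [|t [|t' l]] //=; last exact: homog0.
by rewrite addbF; apply/xi_odd/hw.
Qed.

Lemma homog_half_square l : homog (parity l) (half_square (map w l)).
Proof.
case: l => [|t l] /=; first exact: homog0.
rewrite -[_ (+) _]negbK -addNb -addbN; apply: lie_even (homog_shifted l).
exact/homog_grading_sign/xi_odd/hw.
Qed.

(** Polarization of the fact that [exp(- ad a)] preserves the bracket: each [ad (al w)] is a
    derivation, and the arguments distribute over the two factors. *)
Lemma unshuffle_iter_ad b c x y l : homog b x -> homog c y ->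
  unshuffle_sum l (fun l1 l2 => (-1) ^+ (c && parity l1) *:
     lie (iter_ad x (map w l1)) (iter_ad y (map w l2))) =
  iter_ad (lie x y) (map w l).
Proof.
move=> hx hy; elim: l b c x y hx hy => [|t l IHl] b c x y hx hy /=.
  by rewrite andbF scale1r.
have ht := al_even (hw t).
rewrite -[RHS]/(iter_ad (lie (lie x y) (al (w t))) (map w l)).
have -> : lie (lie x y) (al (w t)) =
    (-1) ^+ (c && e t) *: lie (lie x (al (w t))) y + lie x (lie y (al (w t))).
  rewrite (lie_antisym (lie_even hx hy) ht) (lie_jacobi _ ht hx).
  rewrite (lie_antisym ht hx) (lie_antisym ht hy) !lieE.
  rewrite !(scalerDr, scalerN, scalerA, opprD, opprK) -!signr_addb.
  move: (lie (lie _ _) _) (lie _ (lie _ _)) => u v.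
  by case: (e t) b c {ht hx hy} => [] [] []; rewrite /= ?(scale1r, scaleN1r).
rewrite iter_ad_linear -(IHl _ _ _ _ (lie_even hx ht) hy) -(IHl _ _ _ _ hx (lie_even hy ht)).
rewrite -unshuffle_sumZ; congr (_ + _); apply: eq_unshuffle_sum => l1 l2 /=;
  rewrite !scalerA -!signr_addb; congr (_ ^+ _ *: _);
  by case: (e t) c (parity l1) {ht hy} => [] [] [].
Qed.

(** The same automorphism property with [d + x'] as second factor:
    [[exp(- ad a) x, exp(- ad a)(d + x')] = exp(- ad a)[x, d + x']]. *)
Lemma unshuffle_iter_exp b x l : homog b x ->
  unshuffle_sum l (fun l1 l2 => (-1) ^+ parity l1 *:
     lie (iter_ad x (map w l1)) (exp_ad (map w l2))) =
  unshuffle_sum l (fun l1 l2 =>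
     iter_ad (lie x (shifted (map w l1))) (map w l2)).
Proof.
move=> hx; elim: l => [|t l IHl]; first by rewrite /= scale1r.
rewrite !unshuffle_sum_cons; set a := al (w t).
have hxt := xi_odd (hw t); have ha : homog (e t) a by apply/al_even/hw.
transitivity (iter_ad (lie x (xi (w t))) (map w l) -
  (-1) ^+ (e t (+) e t && b) *: lie a (unshuffle_sum l (fun l1 l2 =>
     iter_ad (lie x (shifted (map w l1))) (map w l2)))).
  rewrite -IHl (unshuffle_sum_map _ _ _ (lie_linear_r a)) -scaleNr -unshuffle_sumZ.
  rewrite -(unshuffle_iter_ad _ hx hxt) -!unshuffle_sumD.
  apply: eq_unshuffle_sum => l1 l2.
  rewrite ?parity_cons ?map_cons.
  rewrite (iter_ad_cons _ hx (hw t)) (exp_ad_cons _ (hw t)) -/a.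
  have hi := homog_iter_ad l1 hx; move: (iter_ad x _) hi => i hi.
  move: (exp_ad _) (iter_ad _ _) => z y.
  rewrite !lieE (lie_jacobi _ ha hi) !(scalerDr, scalerN, scalerA, opprD, opprK).
  rewrite mulNr -!signr_addb.
  move: (lie (lie _ _) _) (lie i (lie _ _)) (lie i y) => u1 u2 u3.
  rewrite !(mulNr, scaleNr) -!signr_addb addrCA.
  by case: (e t) b (parity l1) {hx hxt ha hi} => [] [] [].
congr (_ + _).
  rewrite -[LHS](unshuffle_sum_nil e l (fun l2 => iter_ad (lie x (xi (w t))) (map w l2))).
  by apply: eq_unshuffle_sum => -[|t1 l1] l2 //=; rewrite lie0r iter_ad0.
rewrite -scaleNr (unshuffle_sum_map _ _ _ (lie_linear_r a)) -unshuffle_sumZ.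
apply: eq_unshuffle_sum => l1 l2; rewrite ?parity_cons ?map_cons.
rewrite (iter_ad_cons _ (lie_even hx (homog_shifted l1)) (hw t)).
rewrite scaleNr scalerN scalerA -signr_addb; congr (- (_ ^+ _ *: _)).
by case: (e t) b (parity l1) {hx hxt ha} => [] [] [].
Qed.

Hypothesis d_square0 : lie d d = 0.

(** Polarization of [[y, y] = exp(- ad a)[d + x, d + x]]. Since [half_square] carries the factor
    [- 1/2], its sum appears twice, and no division by 2 occurs here. *)
Lemma unshuffle_exp_exp l :
  unshuffle_sum l (fun l1 l2 => (-1) ^+ parity l1 *:
     lie (exp_ad (map w l1)) (exp_ad (map w l2))) =
  - (unshuffle_sum l (fun l1 l2 => iter_ad (half_square (map w l1)) (map w l2)) +
     unshuffle_sum l (fun l1 l2 => iter_ad (half_square (map w l1)) (map w l2))).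
Proof.
elim: l => [|t l IHl]; first by rewrite /= d_square0 scaler0 addr0 oppr0.
set C := unshuffle_sum l _ in IHl; set G := unshuffle_sum l _ in IHl.
have ht := xi_odd (hw t); set a := al (w t).
have ha : homog (e t) a by apply/al_even/hw.
pose H := unshuffle_sum l (fun l1 l2 => (-1) ^+ parity l1 *:
     lie (iter_ad (xi (w t)) (map w l1)) (exp_ad (map w l2))).
(* [H] collects the brackets of the new term from [xi (w t)] with [y]. It occurs once from each
   factor, the two being matched by [unshuffle_sum_swap]; the rest is the derivation [ad a] applied
   to [C]. *)
transitivity ((-1) ^+ e t *: H + (-1) ^+ e t *: H - lie a C).
  rewrite unshuffle_sum_cons.
  have -> : (-1) ^+ e t *: H + (-1) ^+ e t *: H - lie a C =
    (-1) ^+ e t *: H + ((-1) ^+ e t *: unshuffle_sum l (fun l1 l2 =>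
      (-1) ^+ (parity l1 && parity l2 (+) parity l2) *:
      lie (iter_ad (xi (w t)) (map w l2)) (exp_ad (map w l1))) - lie a C).
    rewrite -addrA {2}/H unshuffle_sum_swap; congr (_ + (_ *: _ - _)).
    by apply: eq_unshuffle_sum => l1 l2; rewrite scalerA -signr_addb.
  rewrite -!unshuffle_sumZ (unshuffle_sum_map _ _ _ (lie_linear_r a)).
  rewrite -scaleN1r -unshuffle_sumZ -!unshuffle_sumD.
  apply: eq_unshuffle_sum => l1 l2.
  rewrite ?parity_cons ?map_cons !(exp_ad_cons _ (hw t)) -/a.
  have h1 := homog_exp_ad l1; have h2 := homog_iter_ad l2 ht.
  move: (exp_ad (map w l1)) h1 (exp_ad (map w l2)) => z1 h1 z2.
  move: (iter_ad _ (map w l2)) h2 (iter_ad _ (map w l1)) => y2 h2 y1.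
   rewrite !lieE (lie_jacobi _ ha h1) (lie_antisym h1 h2).
  rewrite !(scalerDr, scalerN, scalerA, opprD, opprK, scaleN1r, mulN1r) -!signr_addb.
  move: (lie y1 _) (lie (lie _ _) _) (lie z1 (lie _ _)) (lie y2 z1) => u1 u2 u3 u4.
  rewrite !(mulNr, scaleNr) -!signr_addb -addrA [X in _ = _ + X]addrCA.
  by case: (e t) (parity l1) (parity l2) {ht ha h1 h2} => [] [] [];
    rewrite /= ?(scale1r, scaleN1r, opprK).
have -> : unshuffle_sum (t :: l)
    (fun l1 l2 => iter_ad (half_square (map w l1)) (map w l2)) =
    - ((-1) ^+ e t *: H) - lie a G.
  rewrite unshuffle_sum_cons /G (unshuffle_sum_map _ _ _ (lie_linear_r a)).
  congr (_ + _).
    rewrite /H (unshuffle_iter_exp _ ht) -scaleNr -unshuffle_sumZ.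
    apply: eq_unshuffle_sum => l1 l2; rewrite /= (grading_signE ht) lieZl.
    by rewrite (linfZ (iter_ad_linear _)); case: (e t); rewrite /= ?opprK.
  rewrite -scaleN1r -unshuffle_sumZ; apply: eq_unshuffle_sum => l1 l2.
  rewrite ?parity_cons ?map_cons (iter_ad_cons _ (homog_half_square l1) (hw t)).
  by rewrite scalerN scalerA -signr_addb andbC addbb scale1r scaleN1r.
by rewrite IHl !lieE -opprD !opprD !opprK addrACA.
Qed.

Hypothesis two_neq0 : (2%:R : F) != 0.

Lemma double_eq0 (U : lmodType F) (u : U) : u + u = 0 -> u = 0.
Proof.
move=> uu; have : 2%:R *: u = 0 by rewrite scaler_nat.
by move/eqP; rewrite scaler_eq0 (negPf two_neq0) => /eqP.
Qed.

(** As [y - P y] lies in the kernel, which is a subalgebra, and the image of [P] is abelian,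
    [P[y, y]] equals [P[P y, y] + P[y, P y]], that is, [A + A]. By [unshuffle_exp_exp] it is also
    [- (P G + P G)], and 2 is invertible. *)
Lemma derived_jacobi (P : M -> M) l : linear P ->
    (forall b x, homog b x -> homog b (P x)) ->
    (forall x, P (P x) = P x) -> (forall x y, lie (P x) (P y) = 0) ->
    (forall x y, P x = 0 -> P y = 0 -> P (lie x y) = 0) ->
  unshuffle_sum l (fun l1 l2 => P (iter_ad (half_square (map w l1)) (map w l2) -
    lie (gam (P (exp_ad (map w l1)))) (exp_ad (map w l2)))) = 0.
Proof.
move=> linP evP PP abP kerP; pose X := fun l1 => exp_ad (map w l1).
pose A := unshuffle_sum l (fun l1 l2 => (-1) ^+ parity l1 *: P (lie (P (X l1)) (X l2))).
pose G := unshuffle_sum l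
  (fun l1 l2 => iter_ad (half_square (map w l1)) (map w l2)).
have hX l1 : homog (~~ parity l1) (X l1) by apply: homog_exp_ad.
have -> : unshuffle_sum l (fun l1 l2 => P (iter_ad (half_square (map w l1)) (map w l2) -
    lie (gam (P (exp_ad (map w l1)))) (exp_ad (map w l2)))) = P G + A.
  rewrite /G (unshuffle_sum_map _ _ _ linP) /A -unshuffle_sumD.
  apply: eq_unshuffle_sum => l1 l2; rewrite (linfB linP); congr (_ + _).
  rewrite (grading_signE (evP _ _ (hX l1))) lieZl (linfZ linP) -scaleNr.
  by case: (parity l1); rewrite //= opprK.
have PC : P (unshuffle_sum l (fun l1 l2 => (-1) ^+ parity l1 *: lie (X l1) (X l2))) = A + A.
  rewrite {2}/A [X in _ = _ + X]unshuffle_sum_swap (unshuffle_sum_map _ _ _ linP) -unshuffle_sumD.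
  apply: eq_unshuffle_sum => l1 l2.
  have PlieB : P (lie (X l1) (X l2)) =
      P (lie (P (X l1)) (X l2)) + P (lie (X l1) (P (X l2))).
    have ker x : P (x - P x) = 0 by rewrite (linfB linP) PP subrr.
    have := kerP _ _ (ker (X l1)) (ker (X l2)).
    rewrite !(lieDl, lieDr, lieNl, lieNr) abP !oppr0 addr0.
    by rewrite !(linfB linP) -addrA -opprD => /eqP; rewrite subr_eq0 addrC => /eqP.
  rewrite (linfZ linP) PlieB (lie_antisym (hX l1) (evP _ _ (hX l2))).
  rewrite (linfN linP) (linfZ linP) scalerDr scalerN !scalerA -!signr_addb.
  by case: (parity l1) (parity l2) => [] []; rewrite /= ?(scale1r, scaleN1r, opprK).
apply: double_eq0; rewrite addrACA -PC unshuffle_exp_exp -/G.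
by rewrite (linfN linP) (linfD linP) addrN.
Qed.

(** The Jacobi identity after parity shift: [p], [q], [r] are the parities in [Pi L], and the signs
    are the Koszul signs of the three unshuffles into two elements and one. *)
Lemma jacobi_gam p q r x y z : homog (~~ p) x -> homog (~~ q) y -> homog (~~ r) z ->
  lie (gam (lie (gam x) y)) z + (-1) ^+ (q && r) *: lie (gam (lie (gam x) z)) y +
  (-1) ^+ (p && (q (+) r)) *: lie (gam (lie (gam y) z)) x = 0.
Proof.
move=> hx hy hz; rewrite (grading_signE hx) (grading_signE hy) !lieZl.
rewrite !(linfZ gam_linear) !lieZl (grading_signE (lie_even hx hy)).
rewrite (grading_signE (lie_even hx hz)) (grading_signE (lie_even hy hz)) !lieZl.
rewrite (lie_antisym (lie_even hy hz) hx) (lie_jacobi _ hx hy).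
rewrite (lie_antisym (lie_even hx hz) hy).
rewrite !(scalerDr, scalerN, scalerA) -!signr_addb.
move: (lie (lie _ _) _) (lie _ (lie _ _)) => u v.
apply/eqP; rewrite subr_eq0 -scaleNr; apply/eqP; congr (_ + _);
  by case: p q r {hx hy hz} => [] [] []; rewrite /= ?opprK.
Qed.

(** A nonzero term needs at most two arguments inside [half_square] and at most one inside
    [shifted], so only lists of size at most 3 matter. Filling up with [d], which counts as even
    after the shift, sizes 1, 2 and 3 are instances of [jacobi_gam]; for size 1 the instance gives
    twice the claim. *)
Lemma half_square_jacobi l :
  unshuffle_sum l (fun l1 l2 =>
    lie (gam (half_square (map w l1))) (shifted (map w l2))) = 0.
Proof.
have gam0 : gam 0 = 0 := linf0 gam_linear.
have gl0 x : lie (gam 0) x = 0 by rewrite gam0 lie0l.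
have hd : homog (~~ false) d := d_odd.
have simp := (lie0r, gl0, andbF, addbF, scaler0, addr0, add0r, scale1r).
case: l => [|t1 [|t2 [|t3 [|t4 l]]]].
- by rewrite /= gl0.
- have := jacobi_gam (xi_odd (hw t1)) hd hd.
  rewrite (grading_signE hd) lieZl d_square0 /= !simp.
  exact: double_eq0.
- have := jacobi_gam (xi_odd (hw t1)) (xi_odd (hw t2)) hd.
  by rewrite /= !simp.
- have := jacobi_gam (xi_odd (hw t1)) (xi_odd (hw t2)) (xi_odd (hw t3)).
  by rewrite /= !simp.
have zero f : (forall l1 l2, f l1 l2 = 0 :> M) -> unshuffle_sum l f = 0.
  by move=> f0; rewrite (eq_unshuffle_sum e l f0) unshuffle_sum0.
rewrite !unshuffle_sum_cons !zero ?addr0 // => l1 l2 /=; by rewrite !simp.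
Qed.

End Unshuffles.

End DerivedBrackets.

(** * The cocylinder *)

Lemma gs_predB (F : fieldType) (W : superSpace F) (S : gradedSub W) u v :
  u \in gs_pred S -> v \in gs_pred S -> u - v \in gs_pred S.
Proof. by move=> uS vS; rewrite -scaleN1r; apply/rpredD/rpredZ. Qed.

(** * Transfer of an L-infinity structure to a retract *)

Section Retract.
Variables (F : fieldType) (U W : superSpace F) (B : linfty W).
Variables (i : U -> W) (r : W -> U).
Hypotheses (i_linear : linear i) (r_linear : linear r).
Hypothesis i_even : forall b u, homog b u -> homog b (i u).
Hypothesis r_even : forall b w, homog b w -> homog b (r w).
(* This holds both for subspaces closed under the brackets and for quotients. *)
Hypothesis br_retract : forall s1 s2,
  r (B (i (r (B (map i s1))) :: map i s2)) = r (B (B (map i s1) :: map i s2)).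

Definition retract_br (s : seq U) : U := r (B (map i s)).

Fact retract_br_multilinear s1 s2 : linear (fun u => retract_br (s1 ++ u :: s2)).
Proof.
by move=> c u v; rewrite /retract_br !map_cat /= i_linear br_multilinear r_linear.
Qed.

Fact retract_br_odd n (e : 'I_n -> bool) (w : 'I_n -> U) :
  (forall j, homog (e j) (w j)) ->
  homog (~~ odd (\sum_(j < n) e j)%N) (retract_br [seq w j | j <- enum 'I_n]).
Proof.
move=> hw; apply: r_even; rewrite -map_comp.
by apply: br_odd => j; apply/i_even/hw.
Qed.

Fact retract_br_sym s1 s2 a b u v : homog a u -> homog b v ->
  retract_br (s1 ++ u :: v :: s2) = (-1) ^+ (a && b) *: retract_br (s1 ++ v :: u :: s2).
Proof.
move=> hu hv; rewrite /retract_br !map_cat /=.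
by rewrite (br_sym _ _ _ (i_even hu) (i_even hv)) (linfZ r_linear).
Qed.

(** This is [r] applied to the Jacobiator of [B], since [br_retract] removes the inner [i (r _)]. *)
Fact retract_br_jacobi n (e : 'I_n -> bool) (w : 'I_n -> U) :
  (forall j, homog (e j) (w j)) -> jacobiator retract_br e w = 0.
Proof.
move=> hw; have := br_jacobi B (fun j => i_even (hw j)).
rewrite !jacobiator_unshuffle => /(congr1 r); rewrite (linf0 r_linear) => E.
rewrite -[RHS]E (unshuffle_sum_map _ _ _ r_linear).
apply: eq_unshuffle_sum => l1 l2.
by rewrite /retract_br /= br_retract -!map_comp.
Qed.

Definition retract_linfty : linfty U :=
  Linfty retract_br_multilinear retract_br_odd retract_br_sym retract_br_jacobi.

End Retract.

(** * Adjoining the derivation as an odd element *)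

Section ExtendedAlgebra.
Variables (F : fieldType) (L : lieSuperalg F) (D : L -> L).
Hypothesis derD : odd_derivation D.
Hypothesis D2 : forall x, D (D x) = 0.

Let D_linear : linear D. Proof. by case: derD. Qed.
Let D_odd b x : homog b x -> homog (~~ b) (D x). Proof. by case: derD => _ + _; apply. Qed.
Let D_lie b x y : homog b x -> D (lie x y) = lie (D x) y + (-1) ^+ b *: lie x (D y).
Proof. by case: derD => _ _; apply. Qed.

Definition ext_comp (b : bool) (u : F^o * L) : F^o * L :=
  (if b then u.1 else 0, Defs.pcomp b u.2).

Fact ext_comp_linear b : linear (ext_comp b).
Proof.
move=> c u v; rewrite /ext_comp /= Defs.pcomp_linear.
by case: b; congr pair; rewrite /= ?scaler0 ?addr0.
Qed.

Fact ext_comp_comp b c u :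
  ext_comp b (ext_comp c u) = if b == c then ext_comp c u else 0.
Proof. by rewrite /ext_comp /= pcomp_comp; case: b c => [] []. Qed.

Fact ext_comp_sum u : ext_comp false u + ext_comp true u = u.
Proof. by case: u => c x; congr pair; rewrite /= ?add0r ?pcomp_sum. Qed.

Definition ext_space : superSpace F :=
  SuperSpace ext_comp_linear ext_comp_comp ext_comp_sum.

(** The pair [(c, x)] stands for [c d + x]. The last term is [[x, d] = - (-1)^|x| Dx], and the
    coefficient of [d] is zero because [[d, d] = 0] and [[d, x]] lies in [L]. *)
Definition ext_lie (u v : ext_space) : ext_space :=
  (0, lie u.2 v.2 + u.1 *: D v.2 - v.1 *: D (grading_sign u.2)).

Lemma homog_ext b (u : ext_space) :
  homog b u <-> (u.1 = if b then u.1 else 0) /\ homog b u.2.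
Proof.
case: u => c x; split=> [[hc hx]|[hc hx]]; first by split=> //=; rewrite {1}hc; case: (b).
by rewrite /homog /= /ext_comp /= -hc hx.
Qed.

Fact ext_lie_linear_l v : linear (ext_lie^~ v).
Proof.
move=> c u u'; congr pair; rewrite /= ?scaler0 ?addr0 //.
rewrite grading_sign_linear D_linear lieDl lieZl !scalerDl !scalerDr !scalerN !scalerA.
rewrite opprD [v.1 * c]mulrC.
by rewrite [X in X + _ = _]addrACA [LHS]addrACA.
Qed.

Fact ext_lie_linear_r u : linear (ext_lie u).
Proof.
move=> c v v'; congr pair; rewrite /= ?scaler0 ?addr0 //.
rewrite D_linear lieDr lieZr !scalerDl !scalerDr !scalerN !scalerA.
rewrite opprD [u.1 * c]mulrC.
by rewrite [X in X + _ = _]addrACA [LHS]addrACA.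
Qed.

Fact ext_lie_even a b u v : homog a u -> homog b v -> homog (a (+) b) (ext_lie u v).
Proof.
move=> /homog_ext[hu1 hu2] /homog_ext[hv1 hv2]; apply/homog_ext; split=> /=.
  by case: (a (+) b).
apply: homogB; first apply: homogD.
- exact: lie_even.
- rewrite hu1; case: (a); last by rewrite scale0r; apply: homog0.
  by rewrite addTb; apply/homogZ/D_odd.
- rewrite hv1; case: (b); last by rewrite scale0r; apply: homog0.
  by rewrite addbT; apply/homogZ/D_odd/homog_grading_sign.
Qed.

Fact ext_lie_antisym a b u v : homog a u -> homog b v ->
  ext_lie u v = - ((-1) ^+ (a && b) *: ext_lie v u).
Proof.
move=> /homog_ext[hu1 hu2] /homog_ext[hv1 hv2]; congr pair; rewrite /= ?scaler0 ?oppr0 //.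
rewrite (grading_signE hu2) (grading_signE hv2) (lie_antisym hu2 hv2) hu1 hv1.
rewrite !(linfZ D_linear) !(scalerDr, scalerN, scalerA, opprD, opprK).
rewrite [RHS]addrAC; move: (lie _ _) (D _) (D _) => x y z.
case: a b {hu1 hu2 hv1 hv2} => [] [] /=;
  by rewrite ?expr1 ?expr0 ?(mulr1, mul1r, mulrN1, mulN1r, mul0r, mulr0, scale0r,
    opprK, oppr0, scaleNr).
Qed.

Fact ext_lie_jacobi a b u v z : homog a u -> homog b v ->
  ext_lie u (ext_lie v z) =
  ext_lie (ext_lie u v) z + (-1) ^+ (a && b) *: ext_lie v (ext_lie u z).
Proof.
move=> hu hv; have huv := ext_lie_even hu hv.
move: hu hv huv => /homog_ext[hu1 hu2] /homog_ext[hv1 hv2] /homog_ext[_ huv].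
congr pair; first by rewrite /= scaler0 addr0.
rewrite /= in huv *; rewrite (grading_signE huv) (grading_signE hu2) (grading_signE hv2).
rewrite !scale0r !addr0 ?subr0 ?add0r.
rewrite !(linfZ D_linear, linfD D_linear, linfN D_linear, D2).
rewrite !(scaler0, addr0, oppr0, lieDl, lieDr, lieNl, lieNr, lieZl, lieZr) (lie_jacobi _ hu2 hv2).
rewrite !(D_lie _ hu2) !(D_lie _ hv2) (lie_antisym (D_odd hu2) hv2) hu1 hv1.
move: {huv} (z.2) (z.1) => t c''.
case: a b hu1 hu2 hv1 hv2 => [] [] hu1 hu2 hv1 hv2 /=;
  rewrite ?(expr1, expr0, scaler0, scale0r, addr0, add0r, oppr0, subr0, sub0r,
    scalerDr, scalerN, scaleNr, scalerA, scale1r, opprK, mulN1r, mulrN1, mul1r,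
    mulr1, mulNr, mulrN, opprD, addrA).
(* One line for each choice of the two parities; the permutation places cancelling terms next to
   each other. *)
- by rewrite [RHS](ACl (1*6*10*5*2*7*3*9*4*8))/= !addrK.
- by rewrite [RHS](ACl (1*5*4*2*6*3*7))/= subrK.
- by rewrite [RHS](ACl (1*5*8*4*2*7*3*6))/= addrK subrK.
- by rewrite [RHS](ACl (1*4*3*2*5))/= addrK.
Qed.

Definition ext_alg : lieSuperalg F :=
  LieSuperalg ext_lie_linear_l ext_lie_linear_r ext_lie_even ext_lie_antisym
    ext_lie_jacobi.

End ExtendedAlgebra.

(** * The L-infinity algebra on the cocylinder *)

Section Corollary.
Variables (F : fieldType) (L : lieSuperalg F) (K V : gradedSub L).
Hypothesis (two_neq0 : (2%:R : F) != 0) (LKV : direct_decomposition K V).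
Hypotheses (subK : subalgebra K) (abV : abelian_sub V).
Variables (P : L -> sub_space V) (D : L -> L).
Hypotheses (projP : is_projector K P) (derD : odd_derivation D).
Hypothesis D2 : forall x, D (D x) = 0.
Hypothesis DK : forall x, x \in gs_pred K -> D x \in gs_pred K.

Let D_linear : linear D. Proof. by case: derD. Qed.

Lemma proj_val v : P (val v) = v.
Proof. by rewrite -[val v]add0r projP // rpred0. Qed.

Lemma proj_eq0 k : k \in gs_pred K -> P k = 0.
Proof. by move=> kK; rewrite -[k]addr0 -[0]/(val (0 : sub_space V)) projP. Qed.

Lemma sub_proj_in x : x - val (P x) \in gs_pred K.
Proof.
case: LKV => dec _; have [k [v [kK vV ->]]] := dec x.
by rewrite -[v]/(val (Subsp vV)) projP // addrK.
Qed.

Lemma proj_eq0E x : P x = 0 -> x \in gs_pred K.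
Proof. by move=> Px; have := sub_proj_in x; rewrite Px subr0. Qed.

Lemma proj_linear : linear P.
Proof.
move=> c x y; rewrite -[c *: x + y](subrK (val (c *: P x + P y))) projP //.
rewrite -[val (_ + _)]/(c *: val (P x) + val (P y)) opprD addrACA -scalerBr.
by apply: rpredD; [apply: rpredZ|]; apply: sub_proj_in.
Qed.

Lemma proj_even b x : homog b x -> homog b (P x).
Proof.
rewrite /homog => hx; rewrite -{2}hx -{2}[x](subrK (val (P x))).
rewrite (linfD (@Defs.pcomp_linear F L b)).
rewrite -[Defs.pcomp b (val (P x))]/(val (Defs.pcomp b (P x))) projP //.
exact/gs_comp/sub_proj_in.
Qed.

Local Notation M := (ext_alg derD D2).
Local Notation Z := (dsum_space (Pi_space L) (sub_space V)).

Definition ext_l (z : Z) : M := (0, z.1).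
Definition ext_v (z : Z) : M := (0, val z.2).
Definition ext_d : M := (1, 0).

Lemma ext_l_linear : linear ext_l.
Proof. by move=> c u v; congr pair; rewrite /= ?scaler0 ?addr0. Qed.

Lemma ext_v_linear : linear ext_v.
Proof. by move=> c u v; congr pair; rewrite /= ?scaler0 ?addr0. Qed.

Lemma ext_l_odd b z : homog b z -> homog (~~ b) (ext_l z).
Proof.
by move=> hz; apply/homog_ext; split; [case: (~~ b)|apply: (congr1 fst hz)].
Qed.

Lemma ext_v_even b z : homog b z -> homog b (ext_v z).
Proof.
move=> hz; apply/homog_ext; split; first by case: (b).
exact: (congr1 (fun z => val z.2) hz).
Qed.

Lemma ext_v_abelian y z : lie (ext_v y) (ext_v z) = 0.
Proof. by congr pair; rewrite /= abV ?scale0r ?subr0 ?addr0 //; apply: valP. Qed.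

Lemma ext_d_odd : homog true ext_d.
Proof. by apply/homog_ext; split => //; apply: homog0. Qed.

Lemma ext_d_square : lie ext_d ext_d = 0.
Proof.
congr pair; rewrite /= lie0r (linf0 D_linear) (linf0 (@grading_sign_linear F L)).
by rewrite (linf0 D_linear) !scaler0 addr0 subr0.
Qed.

Definition ext_proj (u : M) : M := (0, val (P u.2)).

Local Notation half := (half_square ext_l ext_d).
Local Notation ead := (exp_ad ext_l ext_v ext_d).

(** Taking second components discards the coefficient of [d]. It vanishes for [half s], and dropping
    it in [ead [::] = d] is the convention [P d = 0], which makes the 0-ary bracket zero. *)
Definition cocyl_br (s : seq Z) : Z := ((half s).2, P (ead s).2).

Lemma ext_l_br s : ext_l (cocyl_br s) = half s.
Proof. by case: s. Qed.

Lemma ext_v_br s : ext_v (cocyl_br s) = ext_proj (ead s).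
Proof. by []. Qed.

Lemma parity_enum n (e : 'I_n -> bool) :
  parity e (enum 'I_n) = odd (\sum_(i < n) e i)%N.
Proof.
rewrite -big_enum /=; elim: (enum _) => [|i l IHl] /=; first by rewrite big_nil.
by rewrite big_cons oddD -IHl oddb.
Qed.

Fact cocyl_multilinear s1 s2 : linear (fun z => cocyl_br (s1 ++ z :: s2)).
Proof.
move=> c u v; rewrite /cocyl_br.
rewrite (half_square_multilinear _ ext_l_linear) (exp_ad_multilinear _ ext_l_linear ext_v_linear).
by rewrite /= proj_linear.
Qed.

Fact cocyl_odd n (e : 'I_n -> bool) (w : 'I_n -> Z) :
  (forall i, homog (e i) (w i)) ->
  homog (~~ odd (\sum_(i < n) e i)%N) (cocyl_br [seq w i | i <- enum 'I_n]).
Proof.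
move=> hw; rewrite -parity_enum; congr pair.
  rewrite /= negbK.
  by have /homog_ext[] := homog_half_square ext_l_odd ext_d_odd hw (enum 'I_n).
apply: proj_even.
by have /homog_ext[] := homog_exp_ad ext_l_odd ext_v_even ext_d_odd hw (enum 'I_n).
Qed.

Fact cocyl_sym s1 s2 a b u v : homog a u -> homog b v ->
  cocyl_br (s1 ++ u :: v :: s2) = (-1) ^+ (a && b) *: cocyl_br (s1 ++ v :: u :: s2).
Proof.
move=> hu hv; rewrite /cocyl_br.
rewrite (half_square_sym ext_d ext_l_odd _ _ hu hv).
rewrite (exp_ad_sym ext_d ext_v_linear ext_l_odd ext_v_even ext_v_abelian _ _ hu hv).
by congr pair; rewrite (linfZ proj_linear).
Qed.

Fact cocyl_jacobi n (e : 'I_n -> bool) (w : 'I_n -> Z) :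
  (forall i, homog (e i) (w i)) -> jacobiator cocyl_br e w = 0.
Proof.
move=> hw; rewrite jacobiator_unshuffle; set J := unshuffle_sum _ _ _.
suff [Jl Jv] : ext_l J = 0 /\ ext_v J = 0.
  case: J Jl Jv => x a /(congr1 snd) /= -> /(congr1 snd) /= av; congr pair.
  exact: val_inj.
split.
  rewrite /J (unshuffle_sum_map _ _ _ ext_l_linear).
  rewrite -[RHS](half_square_jacobi ext_l_odd ext_d_odd hw ext_d_square two_neq0 (enum 'I_n)).
  by apply: eq_unshuffle_sum => l1 l2; rewrite ext_l_br /= ext_l_br.
rewrite /J (unshuffle_sum_map _ _ _ ext_v_linear).
rewrite -[RHS](derived_jacobi ext_v_linear ext_l_odd ext_v_even ext_v_abelian ext_d_odd hw
  ext_d_square two_neq0 (P := ext_proj) (enum 'I_n)).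
- by apply: eq_unshuffle_sum => l1 l2; rewrite ext_v_br /= ext_l_br ext_v_br.
- by move=> c x y; congr pair; rewrite /= ?scaler0 ?addr0 ?proj_linear.
- move=> b x /homog_ext[_ hx]; apply/homog_ext; split; first by case: (b).
  exact: (congr1 (fun v : sub_space V => val v) (proj_even hx)).
- by move=> x; congr pair; rewrite /= proj_val.
- by move=> x y; apply: (ext_v_abelian (0, P x.2) (0, P y.2)).
have P0 x : ext_proj x = 0 -> P x.2 = 0.
  by move=> /(congr1 snd) /= Px; apply: val_inj.
move=> x y /P0 Px /P0 Py; congr pair.
have xK := proj_eq0E Px; have yK := proj_eq0E Py.
(* The kernel of [ext_proj] is spanned by [d] and [K]; it is a subalgebra because [K] is one and [D]
   preserves [K]. *)
rewrite proj_eq0 //=; apply: gs_predB; first apply: rpredD.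
- exact: subK.
- exact/rpredZ/DK.
- by apply/rpredZ/DK; apply: gs_predB; apply: gs_comp.
Qed.

Definition cocyl_linfty : linfty Z :=
  Linfty cocyl_multilinear cocyl_odd cocyl_sym cocyl_jacobi.

Lemma iter_ad_inV x (s : seq (sub_space V)) :
  iter_ad ext_v (0, x) [seq ((0, a) : Z) | a <- s] = (0, iter_lie x s).
Proof.
elim: s x => [|a s IHs] x //.
rewrite -[RHS]/(0, iter_lie (lie x (val a)) s) -IHs map_cons.
rewrite -[LHS]/(iter_ad ext_v (lie (l := M) (0, x) (0, val a)) _); congr iter_ad.
by congr pair; rewrite /= !scale0r addr0 subr0.
Qed.

Lemma iter_ad_inL u x s : iter_ad ext_v u (((x, 0) : Z) :: s) = 0.
Proof.
by rewrite -[LHS]/(iter_ad ext_v (lie u 0) s) lie0r iter_ad0.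
Qed.

Lemma exp_ad_inV (s : seq (sub_space V)) :
  ead [seq ((0, a) : Z) | a <- s] = iter_ad ext_v ext_d [seq ((0, a) : Z) | a <- s].
Proof. exact: exp_ad_xi0 ext_v_linear ext_v_even ext_v_abelian ext_d_odd _ _ _ _. Qed.

Lemma lie_ext x y : lie (l := M) (0, x) (0, y) = (0, lie x y).
Proof. by congr pair; rewrite /= !scale0r addr0 subr0. Qed.

Lemma lie_ext_dl x : lie (l := M) ext_d (0, x) = (0, D x).
Proof. by congr pair; rewrite /= lie0l add0r scale1r scale0r subr0. Qed.

Lemma lie_ext_dr x : lie (l := M) (0, x) ext_d = (0, - D (grading_sign x)).
Proof. by congr pair; rewrite /= lie0r add0r scale0r scale1r sub0r. Qed.

Lemma grading_sign_ext x : @grading_sign F M (0, x) = (0, grading_sign x).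
Proof. by congr pair; rewrite /= subr0. Qed.

Lemma half_square_cons z s :
  half (z :: s) = lie (l := M) (0, grading_sign (W := L) z.1) (shifted ext_l ext_d s).
Proof.
exact: (congr1 (fun u : M => lie u (shifted ext_l ext_d s)) (grading_sign_ext z.1)).
Qed.

Lemma shifted_ext s : s != [::] -> (forall z, z \in s -> z.1 = 0) ->
  shifted ext_l ext_d s = 0.
Proof.
case: s => [|z [|z' s]] //= _ s0; rewrite /ext_l (s0 z) //.
by rewrite inE eqxx.
Qed.

Lemma exp_ad_inL x s : ead (((x, 0) : Z) :: s) = iter_ad ext_v (0, x) s.
Proof.
rewrite -[LHS]/(iter_ad ext_v (0, x) s - lie (@grading_sign F M 0) (ead s)).
by rewrite (linf0 (@grading_sign_linear F M)) lie0l subr0.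
Qed.

(** If the head of the list lies in [L], [exp_ad] reduces to iterated brackets of that head
    ([exp_ad_inL]), and a second argument from [L] annihilates them since [ext_v] vanishes on it. If
    all arguments lie in [V], [exp_ad] starts from [[d, a] = Da]. *)
Lemma cocyl_brackets : cocylinder_brackets P D cocyl_linfty.
Proof.
have gam0 : grading_sign (0 : L) = 0 := linf0 (@grading_sign_linear F L).
have P0 : P 0 = 0 := linf0 proj_linear.
have half0 s : half (((0, 0) : Z) :: s) = 0.
  by rewrite half_square_cons gam0 lie0l.
split; split.
- by congr pair; rewrite /= P0.
- move=> x a; congr pair; first by rewrite half_square_cons lie_ext_dr grading_signK.
  rewrite -[ead _]/(ext_l (x, a) - lie (@grading_sign F M (0, val a)) ext_d).
  by rewrite grading_sign_ext lie_ext_dr grading_signK /= opprK.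
- move=> e x y hx; congr pair.
    by rewrite half_square_cons lie_ext /= (grading_signE hx) lieZl.
  by rewrite exp_ad_inL iter_ad_inL.
- move=> x [|a s] // _; congr pair; last by rewrite exp_ad_inL iter_ad_inV.
  rewrite half_square_cons shifted_ext ?lie0r // => z.
  by rewrite inE => /orP[/eqP->|/mapP[b _ ->]].
- move=> a s; congr pair; first by rewrite half_square_cons gam0 lie0l.
  rewrite exp_ad_inV map_cons.
  by rewrite -[iter_ad _ _ _]/(iter_ad ext_v (lie ext_d (0, val a)) _) lie_ext_dl iter_ad_inV.
move=> x y [|z s] // _; congr pair; first by rewrite half_square_cons lie0r.
by rewrite exp_ad_inL iter_ad_inL.
Qed.

(** * The structures on [Pi L], [Pi K] and [V], and the maps between them *)

Local Notation PiL := (Pi_space L).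
Local Notation PiK := (Pi_space (sub_space K)).
Local Notation j := (@cocyl_j F L K V).
Local Notation p := (@cocyl_p F L V).
Local Notation iota := (@fiber_map F L V).

Definition in_l (x : PiL) : Z := (x, 0).
Definition proj_v (z : Z) : sub_space V := z.2.
(** The transfer requires a linear retraction defined on the whole cocylinder; it is the projection
    onto [K] along [V] of the first component. *)
Definition proj_k (z : Z) : PiK := Subsp (sub_proj_in z.1).

Lemma in_l_linear : linear in_l.
Proof. by move=> c x y; congr pair; rewrite /= scaler0 addr0. Qed.

Lemma in_l_even b x : homog b x -> homog b (in_l x).
Proof. by move=> hx; congr pair => //; apply: homog0. Qed.

Lemma cocyl_j_linear : linear j.
Proof. by move=> c x y; congr pair; rewrite /= scaler0 addr0. Qed.

Lemma incl_map_even b (x : PiK) : homog b x -> homog b (@incl_map F L K x).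
Proof. by move=> hx; apply: (congr1 (fun k : sub_space K => val k) hx). Qed.

Lemma cocyl_j_even b (x : PiK) : homog b x -> homog b (j x).
Proof. by move=> hx; apply/in_l_even/incl_map_even. Qed.

Lemma fiber_map_linear : linear iota.
Proof. by move=> c x y; congr pair; rewrite /= scaler0 addr0. Qed.

Lemma fiber_map_even b a : homog b a -> homog b (iota a).
Proof. by move=> ha; congr pair => //; apply: (homog0 (Pi_space L)). Qed.

Lemma cocyl_p_even b z : homog b z -> homog b (p z).
Proof. by move=> hz; apply: (congr1 fst hz). Qed.

Lemma proj_v_even b z : homog b z -> homog b (proj_v z).
Proof. by move=> hz; apply: (congr1 snd hz). Qed.

Lemma proj_k_linear : linear proj_k.
Proof.
move=> c u v; apply: val_inj; rewrite /= proj_linear.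
rewrite -[subsp_val (_ + _)]/(c *: val (P u.1) + val (P v.1)).
by rewrite opprD addrACA -scalerBr.
Qed.

Lemma proj_k_even b z : homog b z -> homog b (proj_k z).
Proof.
move=> hz; apply: val_inj; have hx : homog (~~ b) (z.1 : L) := congr1 fst hz.
have hPx := congr1 (fun v : sub_space V => val v) (proj_even hx).
rewrite /= (linfB (@Defs.pcomp_linear F L _)).
congr (_ - _); [exact: hx|exact: hPx].
Qed.

Lemma cocyl_p_br s : p (cocyl_br s) = p (cocyl_br (map in_l (map p s))).
Proof. by case: s => [|z [|z' [|z'' s]]]. Qed.

Lemma cocyl_inV_br s : cocyl_br (map iota s) = iota (proj_v (cocyl_br (map iota s))).
Proof.
congr pair; case: s => [|a s] //.
have gam0 : grading_sign (0 : L) = 0 := linf0 (@grading_sign_linear F L).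
by rewrite -[LHS]/((half (iota a :: map iota s)).2) half_square_cons gam0 lie0l.
Qed.

Lemma shifted_in_K (s : seq PiK) x : x \in gs_pred K ->
  (lie (l := M) (0, x) (shifted ext_l ext_d (map j s))).2 \in gs_pred K.
Proof.
move=> xK; case: s => [|k [|k' s]].
- rewrite lie_ext_dr /= -scaleN1r; apply/rpredZ/DK.
  by apply: gs_predB; apply: gs_comp.
- by rewrite lie_ext; apply: subK => //; apply: valP.
- by rewrite lie0r rpred0.
Qed.

(** The image of [j] is closed under the brackets: [K] is a subalgebra stable under [D], and [P]
    kills [K], which disposes of the unary term [P x]. *)
Lemma cocyl_j_br (s : seq PiK) : cocyl_br (map j s) = j (proj_k (cocyl_br (map j s))).
Proof.
suff [sK s0] : (cocyl_br (map j s)).1 \in gs_pred K /\ (cocyl_br (map j s)).2 = 0.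
  congr pair; last exact: s0.
  by rewrite /= /incl_map /= proj_eq0 // subr0.
case: s => [|k s]; first by split; rewrite /= ?rpred0 // (linf0 proj_linear).
split.
  rewrite -[_.1]/((half (j k :: map j s)).2) half_square_cons.
  by apply: shifted_in_K; apply: gs_predB; apply: gs_comp; apply: valP.
rewrite -[_.2]/(P (ead (j k :: map j s)).2) exp_ad_inL.
case: s => [|k' s]; first by apply: proj_eq0; apply: valP.
by rewrite map_cons iter_ad_inL (linf0 proj_linear).
Qed.

(** The quotient case of the transfer: [in_l] itself need not preserve brackets, as [d(x, 0)] has
    [V]-component [P x]. The retract condition holds by computation because [half_square] reads only
    the [L]-component of its head. *)
Definition dgla_linfty : linfty PiL :=
  @retract_linfty F PiL Z cocyl_linfty in_l p in_l_linear (fun _ _ _ => erefl)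
    in_l_even cocyl_p_even (fun _ _ => erefl).

(** Transparent, so that its brackets unfold to those of [cocyl_br]. *)
Definition fiber_linfty : linfty (sub_space V).
apply: (@retract_linfty F _ Z cocyl_linfty iota proj_v fiber_map_linear
  (fun _ _ _ => erefl) fiber_map_even proj_v_even).
by move=> s1 s2; rewrite -cocyl_inV_br.
Defined.

Definition sub_linfty : linfty PiK.
apply: (@retract_linfty F _ Z cocyl_linfty j proj_k cocyl_j_linear
  proj_k_linear cocyl_j_even proj_k_even).
by move=> s1 s2; rewrite -cocyl_j_br.
Defined.

Lemma dgla_linfty_brackets : dgla_brackets D dgla_linfty.
Proof.
case: cocyl_brackets => -[_ B1 B2] [_ _ B3].
split=> [|x|e x y hx|[|x [|y [|z s]]] // _] //.
- exact: (congr1 fst (B1 x 0)).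
- exact: (congr1 fst (B2 e x y hx)).
- exact: (congr1 fst (B3 x y (map in_l (z :: s)) isT)).
Qed.

Lemma sub_linfty_brackets : restricted_brackets dgla_linfty sub_linfty.
Proof.
move=> s; rewrite -[LHS]/((j (proj_k (cocyl_br (map j s)))).1) -cocyl_j_br.
by rewrite -[RHS]/((cocyl_br (map in_l (map _ s))).1) -map_comp.
Qed.

Lemma fiber_linfty_brackets : derived_brackets P D fiber_linfty.
Proof.
case: cocyl_brackets => -[B0 _ _] [_ Bv _].
by split=> [|a s]; [apply: (congr1 snd B0)|apply: (congr1 snd (Bv a s))].
Qed.

Lemma incl_morphism : linfty_morphism sub_linfty dgla_linfty (@incl_map F L K).
Proof. by split=> //; [apply: incl_map_even|apply: sub_linfty_brackets]. Qed.

Lemma cocyl_j_morphism : linfty_morphism sub_linfty cocyl_linfty j.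
Proof.
split; [exact: cocyl_j_linear|exact: cocyl_j_even|].
by move=> s; rewrite [RHS]cocyl_j_br.
Qed.

Lemma cocyl_p_morphism : linfty_morphism cocyl_linfty dgla_linfty p.
Proof. by split=> //; [apply: cocyl_p_even|apply: cocyl_p_br]. Qed.

Lemma fiber_map_morphism : linfty_morphism fiber_linfty cocyl_linfty iota.
Proof.
split; [exact: fiber_map_linear|exact: fiber_map_even|].
by move=> s; rewrite [RHS]cocyl_inV_br.
Qed.

Lemma cocyl_j_inj : injective j.
Proof. by move=> x y /(congr1 fst) /= /val_inj. Qed.

Lemma cocyl_unary x a : cocyl_linfty [:: ((x, a) : Z)] = (- D x, P (x + D (val a))).
Proof. by case: cocyl_brackets => -[_ B1 _] _; apply: B1. Qed.

Lemma sub_unary (k : PiK) : val (sub_linfty [:: k] : sub_space K) = - D (val k).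
Proof. by rewrite sub_linfty_brackets; case: dgla_linfty_brackets => _ ->. Qed.

Lemma cocyl_j_quasi_iso : quasi_isomorphism sub_linfty cocyl_linfty j.
Proof.
have [_ _ j_br] := cocyl_j_morphism.
split; split; first exact: cocyl_j_morphism.
- apply: cocyl_j_inj; rewrite j_br (linf0 cocyl_j_linear).
  by case: cocyl_brackets => -[].
- by case: cocyl_brackets => -[].
- move=> x cx; rewrite /cocycle -[[:: j x]]/(map j [:: x]) -j_br cx.
  exact: linf0 cocyl_j_linear.
- move=> x y [z xy]; exists (j z); rewrite -[[:: j z]]/(map j [:: z]) -j_br -xy.
  by rewrite (linfB cocyl_j_linear).
- move=> x y _ _ [[z a]]; rewrite cocyl_unary => E.
  have /= xy := congr1 fst E; have /= Pz := congr1 snd E.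
  have zK : z + D (val a) \in gs_pred K.
    by apply: proj_eq0E; rewrite -Pz subr0.
  (* Replacing the primitive [z] by [z + Da] moves it into [K] without changing its differential,
     because [D^2 = 0]. *)
  exists (Subsp zK : PiK); apply: val_inj.
  by rewrite sub_unary /= (linfD D_linear) D2 addr0 -xy.
move=> [x a]; rewrite /cocycle cocyl_unary => E.
have /= Dx := congr1 fst E; have /= Px := congr1 snd E.
have xK : x + D (val a) \in gs_pred K by apply: proj_eq0E.
exists (Subsp xK : PiK).
  apply: val_inj; rewrite sub_unary /= (linfD D_linear) D2 addr0; exact: Dx.
(* The differential of [(- a, 0)] is [(Da, - a)], which is [j (x + Da) - (x, a)]. *)
exists ((- val a, 0) : Z); rewrite cocyl_unary.
rewrite (linf0 D_linear) addr0 (linfN proj_linear) proj_val (linfN D_linear) opprK.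
congr pair; last exact: sub0r.
by rewrite [LHS]addrAC subrr add0r.
Qed.

End Corollary.

Theorem corollary4p1 (F : fieldType) (char0 : [pchar F] =i pred0)
  (L : lieSuperalg F) (K V : gradedSub L)
  (LKV : direct_decomposition K V)
  (subK : subalgebra K) (subV : subalgebra V) (abV : abelian_sub V)
  (P : L -> sub_space V) (projP : is_projector K P)
  (D : L -> L) (derD : odd_derivation D)
  (D2 : forall x, D (D x) = 0)
  (DK : forall x, x \in gs_pred K -> D x \in gs_pred K) :
  exists (BL : linfty (Pi_space L))
         (BK : linfty (Pi_space (sub_space K)))
         (BZ : linfty (dsum_space (Pi_space L) (sub_space V)))
         (BV : linfty (sub_space V)),
    [/\ dgla_brackets D BL, restricted_brackets BL BK,
        cocylinder_brackets P D BZ & derived_brackets P D BV] /\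
    [/\ linfty_morphism BK BL (@incl_map F L K),
        is_cocylinder BK BL BZ
          (@incl_map F L K) (@cocyl_j F L K V) (@cocyl_p F L V)
      & is_fiber BL BZ BV (@cocyl_p F L V) (@fiber_map F L V)].
Proof.
have two_neq0 : (2%:R : F) != 0.
  by have := char0 2; rewrite !inE /= => ->.
exists (dgla_linfty two_neq0 LKV subK abV projP derD D2 DK).
exists (sub_linfty two_neq0 LKV subK abV projP derD D2 DK).
exists (cocyl_linfty two_neq0 LKV subK abV projP derD D2 DK).
exists (fiber_linfty two_neq0 LKV subK abV projP derD D2 DK).
split; split.
- exact: dgla_linfty_brackets.
- exact: sub_linfty_brackets.
- exact: cocyl_brackets.
- exact: fiber_linfty_brackets.
- exact: incl_morphism.
- split=> //.
  + by split; [apply: cocyl_j_morphism|apply: cocyl_j_inj].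
  + exact: cocyl_j_quasi_iso.
  + by split; [apply: cocyl_p_morphism|move=> x; exists (x, 0)].
split; [exact: cocyl_p_morphism|exact: fiber_map_morphism| |].
  by move=> a b /(congr1 snd).
move=> [x a]; split=> [/= x0|[b <-]] //.
by exists a; rewrite /fiber_map -x0.
Qed.
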